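(* Let $0\le\nu\le p$ be integers with $p-\nu$ even. Let $K$ be a Lipschitz-continuous, symmetric density function with support $[-1,1]$, and let $m$ have $p+2$ continuous derivatives on $[0,1]$ with $m^{(p+1)}(x)\ne0$ for all $x\in[0,1]$. With $\mathbf S,\tilde{\mathbf S},\mathbf c,\tilde{\mathbf c}$ as in the context, assume $\mathbf e_\nu'\mathbf S^{-1}\tilde{\mathbf S}\mathbf S^{-1}\mathbf c-\mathbf e_\nu'\mathbf S^{-1}\tilde{\mathbf c}\neq0$ and put $$\gamma=\frac{\mathbf e_\nu'\mathbf S^{-1}\tilde{\mathbf c}}{\mathbf e_\nu'\mathbf S^{-1}\tilde{\mathbf S}\mathbf S^{-1}\mathbf c-\mathbf e_\nu'\mathbf S^{-1}\tilde{\mathbf c}},\qquad f_0(x)=d_0^{-1}\left|m^{(p+1)}(x)\right|^{\gamma/(p+2)},\quad x\in[0,1],$$ where $d_0$ is such that $\int_0^1f_0(x)\,dx=1$. Then $f_0$ is the solution, among positive continuously differentiable probability densities $f$ on $[0,1]$, of the equation $$\frac{m^{(p+2)}(x)}{(p+2)!}\,\mathbf e_\nu'\mathbf S^{-1}\tilde{\mathbf c}+\frac{m^{(p+1)}(x)}{(p+1)!}\frac{f'(x)}{f(x)}\left(\mathbf e_\nu'\mathbf S^{-1}\tilde{\mathbf c}-\mathbf e_\nu'\mathbf S^{-1}\tilde{\mathbf S}\mathbf S^{-1}\mathbf c\right)=0,\qquad x\in[0,1].$$ Moreover, suppose the bandwidth $h=h(\nu,n,N)>0$ satisfies $h\to0$,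 $Nh^2\to\infty$ and $nh^{2\nu}\to\infty$ as $n,N\to\infty$, and the covariance function $\rho$ is continuous on $[0,1]^2$ with continuous first-order partial derivatives off the main diagonal, having left and right limits $\rho^{(0,1)}(x,x^-)=\lim_{y\nearrow x}\rho^{(0,1)}(x,y)$ and $\rho^{(0,1)}(x,x^+)=\lim_{y\searrow x}\rho^{(0,1)}(x,y)$ on the main diagonal. Then, for the sampling density $f=f_0$ and every $x\in(0,1)$, $\mathrm{Bias}(\hat m_\nu(x))=o(h^{p+2-\nu})$ as $n,N\to\infty$.
   Context: Model. One observes $Y_i(x_j)=m(x_j)+\varepsilon_i(x_j)$, $i=1,\dots,n$, $j=1,\dots,N$, where $m:[0,1]\to\mathbb R$ is a (non-random) regression function and $\varepsilon_1,\dots,\varepsilon_n$ are i.i.d. stochastic processes on $[0,1]$ with mean zero and covariance function $\rho(y,z)=\mathbb E[\varepsilon_i(y)\varepsilon_i(z)]$. The design points $x_j=x_{j,N}$ are determined by a continuous positive probability density $f$ on $[0,1]$ (the sampling density) through $\int_0^{x_j}f(t)\,dt=\frac{j-1}{N-1}$, $j=1,\dots,N$. Estimator. Let $\bar Y_{\cdot j}=\frac1n\sum_{i=1}^nY_i(x_j)$. Given a bandwidth $h>0$ and a kernel $K$, let $\hat{\boldsymbol\beta}(x)=(\hat\beta_0(x),\dots,\hat\beta_p(x))$ be the solution of $\min_{\beta_0,\dots,\beta_p}\sum_{j=1}^N\left(\bar Y_{\cdot j}-\sum_{k=0}^p\beta_k(x_j-x)^k\right)^2\frac1hK\left(\frac{x_j-x}{h}\right)$.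 The local polynomial estimator of order $p$ of $m^{(\nu)}(x)$ is $\hat m_\nu(x)=\nu!\,\hat\beta_\nu(x)$. $\mathrm{Bias}(\hat m_\nu(x))=\mathbb E\,\hat m_\nu(x)-m^{(\nu)}(x)$. Notation. $\rho^{(a,b)}$ denotes the partial derivative of order $a$ in the first and $b$ in the second variable. $\mu_k=\int_{-1}^1u^kK(u)\,du$; $\mathbf c=(\mu_{p+1},\dots,\mu_{2p+1})'$, $\tilde{\mathbf c}=(\mu_{p+2},\dots,\mu_{2p+2})'$. With indices $k,l=0,\dots,p$: $\mathbf S=(\mu_{k+l})$, $\tilde{\mathbf S}=(\mu_{k+l+1})$. $(\mathbf e_k)_{k=0,\dots,p}$ is the canonical basis of $\mathbb R^{p+1}$ ($\mathbf e_k$ has a 1 in position $k+1$). A prime on a vector or matrix denotes transpose. *)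

(* Defs.v *)
From HB Require Import structures.
From mathcomp Require Import all_boot all_order all_algebra.
From mathcomp Require Import all_classical all_reals all_analysis.

Set Implicit Arguments.
Unset Strict Implicit.
Unset Printing Implicit Defensive.

Import Order.TTheory GRing.Theory Num.Theory.
Import numFieldNormedType.Exports.

Local Open Scope classical_set_scope.
Local Open Scope ring_scope.

(** A function on [0, 1] is represented by a total function on [R] whose values
    outside [0, 1] are irrelevant.  The difference quotient is therefore taken
    within [0, 1] (one-sided at the endpoints): Mathematical Components'
    [derive1] at 0 and 1 would depend on the values outside [0, 1]. *)
Section derivatives01.
Context {R : realType}.
Implicit Types (g : R -> R) (x : R) (k : nat).

Definition quotient01 g x : set_system R :=
  (fun y => (g y - g x) / (y - x)) @ within `[0, 1] (x^').

Definition derivable01 g x : Prop := cvg (quotient01 g x).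

Definition derive01 g : R -> R := fun x => lim (quotient01 g x).

Definition derive01n k g : R -> R := iter k derive01 g.

Definition C01 k g : Prop :=
  (forall j, (j < k)%N ->
     forall x : R, x \in `[0, 1] -> derivable01 (derive01n j g) x) /\
  {within `[0, 1], continuous (derive01n k g)}.

End derivatives01.

Section kernel_constants.
Context {R : realType}.
Implicit Types (K : R -> R) (p : nat).

Definition kernel_density K : Prop :=
  [/\ lipschitz K,
      forall u, K (- u) = K u,
      forall u, 0 <= K u,
      \int[lebesgue_measure]_u K u = 1 &
      closure [set u | K u != 0] = `[-1, 1]%classic].

Definition mu_ K (k : nat) : R :=
  \int[lebesgue_measure]_(u in `[-1, 1]) (u ^+ k * K u).

Definition matS p K : 'M[R]_p.+1 := \matrix_(k, l) mu_ K (k + l).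
Definition matSt p K : 'M[R]_p.+1 := \matrix_(k, l) mu_ K (k + l).+1.
Definition vecc p K : 'cV[R]_p.+1 := \col_k mu_ K (p + k).+1.
Definition vecct p K : 'cV[R]_p.+1 := \col_k mu_ K (p + k).+2.
Definition evec p (nu : 'I_p.+1) : 'cV[R]_p.+1 := delta_mx nu 0.

(** [e_nu' S^-1 ct]; a 1 x 1 matrix is read as a scalar through its entry. *)
Definition lambdaA p (nu : 'I_p.+1) K : R :=
  ((evec nu)^T *m invmx (matS p K) *m vecct p K) 0 0.

(** [e_nu' S^-1 St S^-1 c] *)
Definition lambdaB p (nu : 'I_p.+1) K : R :=
  ((evec nu)^T *m invmx (matS p K) *m matSt p K *m invmx (matS p K)
     *m vecc p K) 0 0.

Definition gamma_ p (nu : 'I_p.+1) K : R :=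
  lambdaA nu K / (lambdaB nu K - lambdaA nu K).

End kernel_constants.

Section sampling_density.
Context {R : realType}.
Implicit Types (f m K : R -> R).

Definition density01 f : Prop :=
  (forall x : R, x \in `[0, 1] -> 0 < f x) /\
  \int[lebesgue_measure]_(x in `[0, 1]) f x = 1.

Definition f0_ p (nu : 'I_p.+1) K m (d0 : R) : R -> R :=
  fun x => d0^-1 * (`|derive01n p.+1 m x| `^ (gamma_ nu K / p.+2%:R)).

Definition bias_equation p (nu : 'I_p.+1) K m f : Prop :=
  forall x : R, x \in `[0, 1] ->
    derive01n p.+2 m x / (p.+2)`!%:R * lambdaA nu K
    + derive01n p.+1 m x / (p.+1)`!%:R * (derive01 f x / f x)
        * (lambdaA nu K - lambdaB nu K) = 0.

(** The design points of sample size [N >= 2] are [xs 0, ..., xs N.-1]: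
    indices start at 0, so that the quantile levels are [j / (N - 1)]. *)
Definition is_design f (N : nat) (xs : nat -> R) : Prop :=
  forall j, (j < N)%N ->
    xs j \in `[0, 1] /\
    \int[lebesgue_measure]_(t in `[0, xs j]) f t = j%:R / (N.-1)%:R.

End sampling_density.

Section processes.
Local Open Scope ereal_scope.
Context {d} {Omega : measurableType d} {R : realType} (P : probability Omega R).
Implicit Types (eps : nat -> R -> Omega -> R).

(** Generators of the product sigma-algebra of the path space over [0, 1]. *)
Definition cylinder01 : set (set (R -> R)) :=
  [set A | exists t : R, exists B : set R,
     [/\ t \in `[0%R, 1%R], measurable B & A = [set g | B (g t)]]].

Definition sample_path (X : R -> Omega -> R) : Omega -> (R -> R) := fun w t => X t w.

(** Events in terms of the law of a single path: [<<s cylinder01 >>]. *)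
Definition identically_distributed eps : Prop :=
  forall (i : nat) (A : set (R -> R)), <<s cylinder01 >> A ->
    P (sample_path (eps i) @^-1` A) = P (sample_path (eps 0%N) @^-1` A).

(** As [A i] may be the full space, the product rule for the first [n]
    processes contains the one for every finite subfamily. *)
Definition independent_processes eps : Prop :=
  forall (n : nat) (A : nat -> set (R -> R)),
    (forall i, <<s cylinder01 >> (A i)) ->
    P (\bigcap_(i < n) (sample_path (eps i) @^-1` A i))
    = \prod_(i < n) P (sample_path (eps i) @^-1` A i).

Definition error_processes eps (rho : R -> R -> R) : Prop :=
  [/\ forall i (t : R), t \in `[0%R, 1%R] -> eps i t \in Lfun P 2%:E,
      independent_processes eps,
      identically_distributed eps,
      forall i (t : R), t \in `[0%R, 1%R] -> 'E_P[eps i t] = 0 &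
      forall i (y z : R), y \in `[0%R, 1%R] -> z \in `[0%R, 1%R] ->
        'E_P[fun w => (eps i y w * eps i z w)%R] = (rho y z)%:E].

End processes.

Section covariance.
Context {R : realType}.
Implicit Types (rho : R -> R -> R).

Definition d10 rho (y z : R) : R := derive01 (fun t => rho t z) y.
Definition d01 rho (y z : R) : R := derive01 (fun t => rho y t) z.

Definition square01 : set (R * R) := `[0, 1]%classic `*` `[0, 1]%classic.
Definition offdiag01 : set (R * R) := square01 `&` [set q | q.1 != q.2].

(** A left limit at 0 and a right limit at 1 make no sense on [0, 1]. *)
Definition regular_covariance rho : Prop :=
  [/\ {within square01, continuous (fun q : R * R => rho q.1 q.2)},
      forall y z, offdiag01 (y, z) ->
        derivable01 (fun t => rho t z) y /\ derivable01 (fun t => rho y t) z,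
      {within offdiag01, continuous (fun q : R * R => d10 rho q.1 q.2)},
      {within offdiag01, continuous (fun q : R * R => d01 rho q.1 q.2)} &
      (forall x : R, x \in `]0, 1] -> cvg (d01 rho x @ at_left x)) /\
      (forall x : R, x \in `[0, 1[ -> cvg (d01 rho x @ at_right x))].

End covariance.

Section estimator.
Context {R : realType} {Omega : Type}.
Implicit Types (m K : R -> R) (eps : nat -> R -> Omega -> R) (xs : nat -> R).

Definition Ybar m eps xs (n : nat) (w : Omega) (j : nat) : R :=
  n%:R^-1 * \sum_(i < n) (m (xs j) + eps i (xs j) w).

(** Weighted least squares criterion at [x] for the data [y] at [xs]. *)
Definition wls p K (h : R) (N : nat) xs (y : nat -> R) (x : R)
    (beta : 'cV[R]_p.+1) : R :=
  \sum_(j < N) (y j - \sum_(k < p.+1) beta k 0 * (xs j - x) ^+ k) ^+ 2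
               * (h^-1 * K ((xs j - x) / h)).

Definition is_local_poly_fit p K h N xs y x (beta : 'cV[R]_p.+1) : Prop :=
  forall b : 'cV[R]_p.+1, wls K h N xs y x beta <= wls K h N xs y x b.

Definition mhat p (nu : 'I_p.+1) (betahat : Omega -> 'cV[R]_p.+1) : Omega -> R :=
  fun w => (nat_of_ord nu)`!%:R * betahat w nu 0.

End estimator.

(** [fine] is harmless where the estimator is integrable. *)
Definition Bias d (Omega : measurableType d) (R : realType)
    (P : probability Omega R) p (nu : 'I_p.+1) (m : R -> R) (x : R)
    (betahat : Omega -> 'cV[R]_p.+1) : R :=
  fine ('E_P[mhat nu betahat])%E - derive01n nu m x.

(* Main.v *)
(** Since [C01 1] functions satisfy the chain rule within [0, 1], [f0'/f0] is
    [gamma / (p + 2) * m^(p+2) / m^(p+1)], which solves the bias equation; the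
    equation prescribes [f'/f], hence determines [f] up to a factor, and the
    factor is fixed by the total mass.

    For the bias, set [u_j = (x_j - x) / h].  Over the cell [[x_j, x_j+1]] the
    density has mass [1 / (N - 1)], so the mean value theorem turns
    [(N - 1)^-1 h^-1 sum_j u_j^k K(u_j)] into a Riemann sum of [u^k K(u)] with
    weights [f(xi_j) (u_j+1 - u_j)].  Its error is [o(h)] because the mesh of the
    [u_j] is [O(1 / (N h))] and [N h^2 -> +oo]; hence these means are
    [f(x) mu_k + h f'(x) mu_(k+1) + o(h)].  The expectation of the estimator is
    the fit of the data [m(x_j)], whose coefficients solve the normal equations.
    Expanding [m] to order [p + 2] and solving the perturbed system, the
    [nu]-th scaled coefficient error has leading term of order [h^(p+1)]
    proportional to [(S^-1 c)_nu], which vanishes by parity, and its term of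
    order [h^(p+2)] is the left-hand side of the bias equation. *)

Require Import Defs.
From HB Require Import structures.
From mathcomp Require Import all_boot all_order all_algebra.
From mathcomp Require Import all_classical all_reals all_analysis.
From mathcomp Require Import ring lra.

Set Implicit Arguments.
Unset Strict Implicit.
Unset Printing Implicit Defensive.

Import Order.TTheory GRing.Theory Num.Theory.
Import numFieldNormedType.Exports.

Local Open Scope classical_set_scope.
Local Open Scope ring_scope.

(** * Limits of difference quotients restricted to [0, 1] *)

Section derivatives_within_the_unit_interval.
Context {R : realType}.
Implicit Types (g : R -> R) (x l : R).

(** Every point of [0, 1], endpoints included, is an accumulation point of [0, 1]; this makes the
    limit in [derive01] unique. *)
Lemma within01_dnbhs_proper x : x \in `[0, 1] ->
  ProperFilter (within `[0, 1]%classic (x^')).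
Proof.
rewrite in_itv/= => /andP[x0 x1].
split; last exact: within_filter.
rewrite /within/= => /nbhs_ballP[e /= e0 /= xe].
(* A step of length at most 1/4 towards an endpoint at distance at least 1/2 stays in [0, 1]. *)
pose r := Num.min (e / 2) 4^-1.
have r0 : 0 < r by rewrite lt_min; apply/andP; split; lra.
have re : r <= e / 2 by rewrite /r ge_min lexx.
have r4 : r <= 4^-1 by rewrite /r ge_min lexx orbT.
have [h|h] := ltP x 2^-1.
  apply: (xe (x + r)).
  - by rewrite -ball_normE/= opprD addNKr normrN gtr0_norm//; lra.
  - by apply/eqP; lra.
  - by rewrite /= in_itv/=; lra.
apply: (xe (x - r)).
- by rewrite -ball_normE/= opprB addrC subrK gtr0_norm//; lra.
- by apply/eqP; lra.
- by rewrite /= in_itv/=; lra.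
Qed.

Lemma derive01_eq g x l : x \in `[0, 1] -> quotient01 g x --> l ->
  derive01 g x = l.
Proof.
move=> x01 gl; have := within01_dnbhs_proper x01 => P.
exact: (cvg_lim _ gl).
Qed.

Lemma derivable01P g x : derivable01 g x -> quotient01 g x --> derive01 g x.
Proof. by []. Qed.

(** Multiplying the quotient by [y - x], which tends to 0, recovers [g y - g x]; the point [y = x],
    absent from the punctured filter, is added by hand. *)
Lemma quotient01_cvg_within g x l : quotient01 g x --> l ->
  g y @[y --> within `[0, 1]%classic (nbhs x)] --> g x.
Proof.
move=> gl.
have idx : (y - x) @[y --> within `[0, 1]%classic (x^')] --> (0 : R).
  rewrite -(subrr x); apply: cvgB; last exact: cvg_cst.
  apply: cvg_trans (@nbhs_dnbhs _ x); exact: (@cvg_within_filter _ _ id _ _ _ _ cvg_id).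
have gx : g y @[y --> within `[0, 1]%classic (x^')] --> g x.
  have : ((g y - g x) / (y - x) * (y - x) + g x)
      @[y --> within `[0, 1]%classic (x^')] --> l * 0 + g x.
    by apply: cvgD; [exact: cvgM gl idx|exact: cvg_cst].
  rewrite mulr0 add0r; apply: cvg_trans; apply: near_eq_cvg.
  rewrite near_withinE; near=> y => _.
  rewrite divfK ?subrK// subr_eq0.
  by near: y; exact: nbhs_dnbhs_neq.
move=> A Ax.
have : nbhs x (fun y => y != x -> `[0, 1]%classic y -> A (g y)) := gx _ Ax.
rewrite /= => h; change (nbhs x (fun y => `[0, 1]%classic y -> A (g y))).
apply: filterS h => y h y01.
have [->|yx] := eqVneq y x; first exact: nbhs_singleton.
exact: h.
Unshelve. all: by end_near. Qed.

Lemma derivable01_continuous g :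
  (forall x, x \in `[0, 1] -> derivable01 g x) ->
  {within `[0, 1], continuous g}.
Proof.
move=> dg; apply/subspace_continuousP => x /= x01.
exact: quotient01_cvg_within (derivable01P (dg _ x01)).
Qed.

(** Carathéodory's slope function of [phi] at [g x] avoids a division by [g y - g x], which may
    vanish. *)
Lemma quotient01_comp phi g x l a : quotient01 g x --> l ->
  is_derive (g x) 1 phi a -> quotient01 (phi \o g) x --> a * l.
Proof.
move=> gl /is_derive1_caratheodory[q [qE qc qa]].
have cq : q (g y) @[y --> within `[0, 1]%classic (x^')] --> a.
  rewrite -qa; apply: (@cvg_comp _ _ _ g q _ (nbhs (g x)) _ _ qc).
  by move=> A /(quotient01_cvg_within gl); exact: nbhs_dnbhs.
have : (q (g y) * ((g y - g x) / (y - x)))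
  @[y --> within `[0, 1]%classic (x^')] --> a * l by exact: cvgM cq gl.
apply: cvg_trans; apply: near_eq_cvg; near=> y.
by rewrite /= qE mulrA.
Unshelve. all: by end_near. Qed.

(** Some neighbourhood of an interior point lies in [0, 1], so the restriction to [0, 1] disappears
    in the limit. *)
Lemma quotient01_interior g x l : x \in `]0, 1[ -> quotient01 g x --> l ->
  is_derive x 1 g l.
Proof.
move=> x01 gl; apply/is_derive1_caratheodory.
exists (fun y => if y == x then l else (g y - g x) / (y - x)).
split => [z||]; last by rewrite eqxx.
  by case: eqVneq => [->|zx]; rewrite ?subrr ?mulr0// divfK// subr_eq0.
apply/continuous_withinNx; rewrite eqxx.
have h : (g y - g x) / (y - x) @[y --> x^'] --> l.
  move=> A /gl; rewrite /= => h.
  change (x^' (fun y => A ((g y - g x) / (y - x)))).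
  have {}h : x^' (fun y => `[0, 1]%classic y -> A ((g y - g x) / (y - x))) := h.
  near=> y; have: `[0, 1]%classic y -> A ((g y - g x) / (y - x)) by near: y.
  apply; apply: subset_itv_oo_cc.
  near: y; apply: nbhs_dnbhs; exact: near_in_itvoo.
apply: cvg_trans h; apply: near_eq_cvg; near=> y.
rewrite ifF//; apply/negbTE; near: y; exact: nbhs_dnbhs_neq.
Unshelve. all: by end_near. Qed.

Lemma eq_quotient01 g1 g2 x : x \in `[0, 1] ->
  (forall y, y \in `[0, 1] -> g1 y = g2 y) -> quotient01 g1 x = quotient01 g2 x.
Proof.
move=> x01 gg; rewrite /quotient01.
by apply/seteqP; split => A; apply: (@filterS _ (x^')) => y h y01; move: (h y01);
  rewrite /= (gg _ x01) (gg _ y01).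
Qed.

End derivatives_within_the_unit_interval.

(** * Logarithmic derivative of a real power of [|g|] *)

Section power_of_a_nonvanishing_function.
Context {R : realType}.
Implicit Types (f g : R -> R) (x c e : R).

(** A change of sign would force a zero by the intermediate value theorem. The witness [s] is 1 or
    -1; it makes the absolute value linear in [g], hence differentiable. *)
Lemma continuous_nonzero_sign g : {within `[0, 1], continuous g} ->
  (forall x, x \in `[0, 1] -> g x != 0) ->
  exists s : R, forall x, x \in `[0, 1] -> `|g x| = s * g x.
Proof.
move=> cg g0.
have same x : x \in `[0, 1] -> 0 < g 0 * g x.
  move=> x01; have /andP[x0 x1] : 0 <= x <= 1 by move: x01; rewrite in_itv.
  have g00 : g 0 != 0 by apply: g0; rewrite in_itv/= lexx ler01.
  have gx0 := g0 _ x01.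
  rewrite lt_neqAle eq_sym mulf_neq0//= leNgt; apply/negP => gg.
  have [||c c0x gc] := @IVT R g 0 x 0 x0.
  - by apply: continuous_subspaceW cg; exact: subset_itvl.
  - have [h|h] := ltP (g 0) 0; rewrite ge_min le_max.
      have : 0 < g x by rewrite -(nmulr_rlt0 _ h).
      by move=> /ltW ->; rewrite (ltW h) orbT.
    have {}h : 0 < g 0 by rewrite lt_neqAle eq_sym g00.
    have : g x < 0 by rewrite -(pmulr_rlt0 _ h).
    by move=> /ltW ->; rewrite (ltW h) orbT.
  have : c \in `[0, 1].
    by move: c0x; rewrite !in_itv/= => /andP[-> cx]; exact: le_trans x1.
  by move=> /g0; rewrite gc eqxx.
have [h|h] := ltP (g 0) 0.
  exists (-1).
  by move=> x /same; rewrite nmulr_rgt0// => gx; rewrite ltr0_norm// mulN1r.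
exists 1.
move=> x /same; rewrite pmulr_rgt0; first by move=> gx; rewrite gtr0_norm// mul1r.
by rewrite lt_neqAle eq_sym g0// in_itv/= lexx ler01.
Qed.

Lemma is_derive1_powR x e : 0 < x ->
  is_derive x 1 (fun y => y `^ e) (e * x `^ (e - 1)).
Proof.
move=> x0; have xi : x \in `]0, +oo[ by rewrite in_itv/= x0.
split; first exact: derivable_powR.
by rewrite -derive1E powR_derive1.
Qed.

Lemma quotient01_powR_norm g c e x :
  (forall x, x \in `[0, 1] -> derivable01 g x) ->
  (forall x, x \in `[0, 1] -> g x != 0) -> x \in `[0, 1] ->
  quotient01 (fun y => c * `|g y| `^ e) x -->
    c * `|g x| `^ e * (e * (derive01 g x / g x)).
Proof.
move=> dg g0 x01.
have [s sg] := continuous_nonzero_sign (derivable01_continuous dg) g0.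
rewrite (@eq_quotient01 _ _ ((fun z => c * (s * z) `^ e) \o g))//; last first.
  by move=> y y01 /=; rewrite sg.
have sgx : 0 < s * g x by rewrite -sg// normr_gt0 g0.
have s0 : s != 0 by apply: contraTneq sgx => ->; rewrite mul0r ltxx.
have -> : c * `|g x| `^ e * (e * (derive01 g x / g x)) =
          (c * (e * (s * g x) `^ (e - 1) * s)) * derive01 g x.
  rewrite sg// powRB; last by rewrite (gt_eqF sgx) implybT.
  rewrite powRr1 ?ltW//; field.
  by rewrite s0 g0.
apply: quotient01_comp; first exact: derivable01P (dg _ x01).
have d1 : is_derive (g x) 1 (fun z => s * z) s.
  by apply: is_derive_eq; rewrite [LHS]mulr1.
have d2 := is_derive1_comp (is_derive1_powR e sgx) d1.
exact: is_derive_eq.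
Qed.

End power_of_a_nonvanishing_function.

(** * Primitives of continuous functions and the fundamental theorem of calculus *)

Section primitives.
Context {R : realType}.
Notation mu := (@lebesgue_measure R).
Implicit Types (f g F : R -> R) (a b c x y : R).

Lemma continuous_integrable g b c : continuous g ->
  mu.-integrable `[b, c] (EFin \o g).
Proof.
move=> cg; apply: continuous_compact_integrable; first exact: segment_compact.
exact: continuous_subspaceT.
Qed.

(** The base point [a] lies strictly to the left of all points of interest, so that the derivatives
    there are two-sided. *)
Lemma continuous_primitive g a : continuous g ->
  exists G : R -> R, (forall x, a < x -> is_derive x 1 G (g x)) /\
    (forall b c, a < b -> b <= c -> \int[mu]_(t in `[b, c]) g t = G c - G b).
Proof.
move=> cg; exists (fun y => \int[mu]_(t in `[a, y]) g t); split=> [x ax|b c ab bc].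
  have xx1 : x < x + 1 by rewrite ltrDl.
  have [] := continuous_FTC1_closed xx1 (continuous_integrable a (x + 1) cg) ax (cg x).
  by rewrite derive1E => d dE; split.
rewrite Rintegral_itvB//.
- rewrite Rintegral_itv_obnd_cbnd//.
  by apply: integrableS (continuous_integrable b c cg) => //; exact: subset_itv_oc_cc.
- exact: continuous_integrable.
- by rewrite bnd_simp ltW.
Qed.

Lemma is_derive_within_continuous F f b c :
  (forall x, x \in `[b, c] -> is_derive x 1 F (f x)) ->
  {within `[b, c], continuous F}.
Proof.
by move=> dF; apply: derivable_within_continuous => x /dF [].
Qed.

Lemma is_derive_MVT F f b c : b < c ->
  (forall x, x \in `[b, c] -> is_derive x 1 F (f x)) ->
  exists2 x, x \in `]b, c[ & F c - F b = f x * (c - b).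
Proof.
move=> bc dF; have cF := is_derive_within_continuous dF.
have dF' x : x \in `]b, c[ -> is_derive x 1 F (f x).
  by move=> xbc; apply: dF; exact: subset_itv_oo_cc.
exact: MVT bc dF' cF.
Qed.

(** The projection of the line onto [0, 1]; composition with it extends a continuous function on
    [0, 1] to a continuous function on the line. *)
Definition clamp01 x : R := Num.max 0 (Num.min 1 x).

Lemma clamp01_itv x : clamp01 x \in `[0, 1].
Proof. by rewrite in_itv/= /clamp01 le_max lexx/= ge_max ler01/= ge_min lexx. Qed.

Lemma clamp01_id x : x \in `[0, 1] -> clamp01 x = x.
Proof.
rewrite in_itv/= => /andP[x0 x1].
by rewrite /clamp01 min_r// max_r.
Qed.

Lemma clamp01_continuous : continuous clamp01.
Proof.
move=> x; rewrite /clamp01.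
apply: (@continuous_max R R (cst 0) (fun x => Num.min 1 x)); first exact: cvg_cst.
apply: (@continuous_min R R (cst 1) id); first exact: cvg_cst.
exact: cvg_id.
Qed.

Lemma continuous_clamp01 f : {within `[0, 1], continuous f} ->
  continuous (f \o clamp01).
Proof.
move=> /subspace_continuousP cf x.
have := cf _ (clamp01_itv x); apply: cvg_comp.
move=> A /= hA; have : nbhs x (fun y => `[0, 1]%classic (clamp01 y) -> A (clamp01 y)).
  exact: clamp01_continuous hA.
by apply: filterS => y; apply; exact: clamp01_itv.
Qed.

Lemma within01_integrable f y : {within `[0, 1], continuous f} -> y <= 1 ->
  mu.-integrable `[0, y] (EFin \o f).
Proof.
move=> cf y1; have i1 : mu.-integrable `[0, 1] (EFin \o f).
  by apply: continuous_compact_integrable => //; exact: segment_compact.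
by apply: integrableS i1 => //; exact: subset_itvl.
Qed.

(** Take a primitive of the extension [f \o clamp01] with base point -1, for which 0 is an interior
    point, and subtract its value at 0. *)
Lemma primitive01 f : {within `[0, 1], continuous f} ->
  exists F : R -> R, [/\ {within `[0, 1], continuous F},
    forall x, x \in `]0, 1[ -> is_derive x 1 F (f x),
    F 0 = 0 &
    forall y, y \in `[0, 1] -> \int[mu]_(t in `[0, y]) f t = F y].
Proof.
move=> cf.
have [G [dG GE]] := @continuous_primitive (f \o clamp01) (-1) (continuous_clamp01 cf).
have m10 : -1 < 0 :> R by rewrite ltrN10.
have dF x : -1 < x -> is_derive x 1 (fun y => G y - G 0) (f (clamp01 x)).
  by move=> /dG dGx; apply: is_derive_eq; rewrite subr0.
exists (fun y => G y - G 0); split=> [|x x01||y].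
- apply: (@is_derive_within_continuous _ (f \o clamp01)) => x; rewrite in_itv/= => /andP[x0 _].
  by apply: dF; exact: lt_le_trans x0.
- have {2}<- := clamp01_id (subset_itv_oo_cc x01); apply: dF.
  by move: x01; rewrite in_itv/= => /andP[x0 _]; exact: lt_trans x0.
- by rewrite subrr.
- rewrite in_itv/= => /andP[y0 y1].
  rewrite -(GE 0 y m10 y0); apply: eq_Rintegral => t.
  rewrite inE/= in_itv/= => /andP[t0 ty].
  by rewrite /= clamp01_id// in_itv/= t0 (le_trans ty).
Qed.

(** A primitive is nondecreasing with equal values at both ends, hence constant, and its derivative
    vanishes. *)
Lemma ge0_continuous_Rintegral_eq0 g b c : continuous g ->
  (forall x, x \in `]b, c[ -> 0 <= g x) -> \int[mu]_(t in `[b, c]) g t = 0 ->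
  forall x, x \in `]b, c[ -> g x = 0.
Proof.
move=> cg g0 int0 x xbc.
have [G [dG GE]] := @continuous_primitive g (b - 1) cg.
have /andP[bx xc] : b < x < c by move: xbc; rewrite in_itv.
have bb : b - 1 < b by rewrite gtrBl.
have Gle u v : b <= u -> u <= v -> v <= c -> G u <= G v.
  move=> bu uv vc; move: uv; rewrite le_eqVlt => /predU1P[->//|uv].
  have [|w wuv Guv] := @is_derive_MVT G g u v uv.
    by move=> w; rewrite in_itv/= => /andP[uw _]; apply: dG; lra.
  rewrite -subr_ge0 Guv mulr_ge0//; last by rewrite subr_ge0 ltW.
  by apply: g0; move: wuv; rewrite !in_itv/=; lra.
have Gb u : b <= u -> u <= c -> G u = G b.
  move=> bu uc; apply/le_anti; rewrite (Gle b u)// andbT.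
  have : G c = G b by apply/eqP; rewrite -subr_eq0 -GE ?int0//; lra.
  by move=> <-; exact: Gle.
have [d1 <-] : is_derive x 1 G (g x) by apply: dG; lra.
rewrite -(derive_cst (G b) x (1 : R)).
apply: near_eq_derive.
near=> y; have : y \in `]b, c[ by near: y; exact: near_in_itvoo.
by rewrite in_itv/= => /andP[by_ yc]; rewrite Gb// ltW.
Unshelve. all: by end_near. Qed.

End primitives.

(** * Existence and uniqueness of the density solving the bias equation *)

Section optimal_density.
Context {R : realType}.
Notation mu := (@lebesgue_measure R).
Implicit Types (f g K m : R -> R) (x y c : R).

Lemma C01_continuous k j g : C01 k g -> (j <= k)%N ->
  {within `[0, 1], continuous (derive01n j g)}.
Proof.
move=> [dg cg]; rewrite leq_eqVlt => /predU1P[->//|jk].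
by apply: derivable01_continuous => x; exact: dg.
Qed.

Lemma within01_continuousM f g : {within `[0, 1], continuous f} ->
  {within `[0, 1], continuous g} ->
  {within `[0, 1], continuous (fun x : R => f x * g x)}.
Proof.
move=> /subspace_continuousP cf /subspace_continuousP cg.
by apply/subspace_continuousP => x x01; apply: cvgM; [exact: cf|exact: cg].
Qed.

Lemma within01_continuousV f : {within `[0, 1], continuous f} ->
  (forall x, x \in `[0, 1] -> f x != 0) ->
  {within `[0, 1], continuous (fun x : R => (f x)^-1)}.
Proof.
move=> /subspace_continuousP cf f0.
by apply/subspace_continuousP => x x01; apply: cvgV; [exact: f0|exact: cf].
Qed.

(** The quotient [f / g] is continuous on [0, 1] with zero derivative inside, so it keeps its value
    at 0. *)
Lemma derive01_log_unique f g : C01 1 f -> C01 1 g ->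
  (forall x, x \in `[0, 1] -> f x != 0) -> (forall x, x \in `[0, 1] -> g x != 0) ->
  (forall x, x \in `[0, 1] -> derive01 f x / f x = derive01 g x / g x) ->
  exists c, forall x, x \in `[0, 1] -> f x = c * g x.
Proof.
move=> Cf Cg f0 g0 fg; exists (f 0 / g 0) => x x01.
have [x0 x1] : 0 <= x /\ x <= 1 by move: x01; rewrite in_itv/= => /andP.
have cfg : {within `[0, x], continuous (fun y : R => f y * (g y)^-1)}.
  have cfg1 : {within `[0, 1], continuous (fun y : R => f y * (g y)^-1)}.
    apply: within01_continuousM; first exact: (C01_continuous Cf (leqnSn 0)).
    by apply: within01_continuousV => //; exact: (C01_continuous Cg (leqnSn 0)).
  by apply: continuous_subspaceW cfg1; exact: subset_itvl.
have dfg y : y \in `]0, x[ -> is_derive y 1 (fun y => f y * (g y)^-1) 0.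
  rewrite in_itv/= => /andP[y0 yx].
  have y01 : y \in `]0, 1[ by rewrite in_itv/= y0 (lt_le_trans yx).
  have y01' := subset_itv_oo_cc y01.
  have df : is_derive y 1 f (derive01 f y).
    by apply: quotient01_interior => //; apply: derivable01P; exact: (Cf.1 0).
  have dg : is_derive y 1 g (derive01 g y).
    by apply: quotient01_interior => //; apply: derivable01P; exact: (Cg.1 0).
  have dgV := is_deriveV (g0 _ y01') dg.
  apply: is_derive_eq.
  have -> : derive01 f y = derive01 g y / g y * f y.
    by rewrite -fg// divfK// f0.
  rewrite -[LHS]/(f y * (- (g y) ^- 2 * derive01 g y) +
    (g y)^-1 * (derive01 g y / g y * f y)).
  by field; rewrite g0.
have [c _] := MVT_segment x0 dfg cfg.
rewrite mul0r => /eqP; rewrite subr_eq0 => /eqP <-.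
by rewrite divfK ?g0.
Qed.

Variables (p : nat) (nu : 'I_p.+1) (K m : R -> R) (d0 : R).
Hypothesis hm : C01 p.+2 m.
Hypothesis hm_neq0 : forall x, x \in `[0, 1] -> derive01n p.+1 m x != 0.
Hypothesis hd0 : \int[mu]_(x in `[0, 1]) f0_ nu K m d0 x = 1.

Lemma f0_quotient01 x : x \in `[0, 1] -> quotient01 (f0_ nu K m d0) x -->
  f0_ nu K m d0 x *
  (gamma_ nu K / p.+2%:R * (derive01n p.+2 m x / derive01n p.+1 m x)).
Proof.
move=> x01; apply: (@quotient01_powR_norm R (derive01n p.+1 m) d0^-1) => //.
exact: hm.1.
Qed.

Lemma f0_derive01 x : x \in `[0, 1] -> derive01 (f0_ nu K m d0) x =
  f0_ nu K m d0 x *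
  (gamma_ nu K / p.+2%:R * (derive01n p.+2 m x / derive01n p.+1 m x)).
Proof. by move=> x01; apply: derive01_eq => //; exact: f0_quotient01. Qed.

Lemma f0_C01 : C01 1 (f0_ nu K m d0).
Proof.
have df x : x \in `[0, 1] -> derivable01 (f0_ nu K m d0) x.
  by move=> x01; apply/cvg_ex; eexists; exact: f0_quotient01.
split; first by move=> [|//] _.
have cE : {within `[0, 1], continuous (fun x => f0_ nu K m d0 x *
  (gamma_ nu K / p.+2%:R * (derive01n p.+2 m x / derive01n p.+1 m x)))}.
  apply: within01_continuousM; first exact: derivable01_continuous.
  apply: within01_continuousM.
    by apply: continuous_subspaceT => x; exact: cvg_cst.
  apply: within01_continuousM; first exact: hm.2.
  by apply: within01_continuousV => //; exact: (C01_continuous hm (leqnSn _)).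
move: cE => /subspace_continuousP cE; apply/subspace_continuousP => x x01.
change (derive01 (f0_ nu K m d0) y @[y --> within `[0, 1]%classic (nbhs x)] -->
  derive01 (f0_ nu K m d0) x).
rewrite f0_derive01//; apply: cvg_trans (cE x x01).
apply: near_eq_cvg; rewrite near_withinE; near=> y => y01.
by rewrite f0_derive01.
Unshelve. all: by end_near. Qed.

(** The sign of [d0] comes from the normalisation: [d0^-1] times a nonnegative integral equals 1. *)
Lemma f0_gt0 x : x \in `[0, 1] -> 0 < f0_ nu K m d0 x.
Proof.
move=> x01; rewrite /f0_ mulr_gt0//; last by rewrite powR_gt0// normr_gt0 hm_neq0.
pose g := fun x => 1 * `|derive01n p.+1 m x| `^ (gamma_ nu K / p.+2%:R).
have cg : {within `[0, 1], continuous g}.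
  apply: derivable01_continuous => y y01; apply/cvg_ex; eexists.
  by apply: (@quotient01_powR_norm R (derive01n p.+1 m) 1) => //; exact: hm.1.
have : d0^-1 * \int[mu]_(x in `[0, 1]) g x = 1.
  rewrite -RintegralZl//; last exact: within01_integrable.
  by apply: (eq_trans _ hd0); apply: eq_Rintegral => y _; rewrite /g mul1r.
have : 0 <= \int[mu]_(x in `[0, 1]) g x.
  by apply: Rintegral_ge0 => y _; rewrite /g mul1r powR_ge0.
move=> I0 I1; rewrite lt_neqAle eq_sym; apply/andP; split.
  by apply: contra_eq_neq I1 => ->; rewrite mul0r eq_sym oner_neq0.
rewrite leNgt; apply/negP => d0N.
by have := mulr_le0_ge0 (ltW d0N) I0; rewrite I1 leNgt ltr01.
Qed.

Hypothesis hBA : lambdaB nu K - lambdaA nu K != 0.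

(** Once [f0' / f0] is inserted, the left-hand side is [m^(p+2) / (p+2)!] times
    [lambdaA + gamma * (lambdaA - lambdaB)], which vanishes by the choice of [gamma]. *)
Lemma f0_bias_equation : bias_equation nu K m (f0_ nu K m d0).
Proof.
move=> x x01; rewrite f0_derive01// [f0_ _ _ _ _ _ * _]mulrC mulfK; last first.
  by rewrite gt_eqF// f0_gt0.
rewrite /gamma_ factS natrM; field.
by rewrite hBA hm_neq0//= -natrD !pnatr_eq0 -!lt0n fact_gt0.
Qed.

Lemma bias_equation_unique f : C01 1 f -> density01 f ->
  bias_equation nu K m f ->
  forall x, x \in `[0, 1] -> f x = f0_ nu K m d0 x.
Proof.
move=> Cf [f_gt0 f1] bf.
have [|||c fc] := derive01_log_unique Cf f0_C01.
- by move=> x x01; rewrite gt_eqF// f_gt0.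
- by move=> x x01; rewrite gt_eqF// f0_gt0.
(* Equate the two instances of the equation and cancel the nonzero factors [lambdaA - lambdaB] and
   [m^(p+1) / (p+1)!]. *)
- move=> x x01; have := bf _ x01; rewrite -(f0_bias_equation x01).
  move=> /addrI /mulIf; rewrite -oppr_eq0 opprB => /(_ hBA) /mulfI; apply.
  by rewrite mulf_neq0 ?hm_neq0// invr_eq0 pnatr_eq0 -lt0n fact_gt0.
have c1 : c = 1.
  rewrite -[c]mulr1 -{1}hd0 -RintegralZl//; last first.
    exact: within01_integrable (C01_continuous f0_C01 (leqnSn 0)) _.
  by apply: (eq_trans _ f1); apply: eq_Rintegral => x; rewrite inE/= => x01; rewrite fc.
by move=> x x01; rewrite fc// c1 mul1r.
Qed.

End optimal_density.

(** * Taylor's formula with Peano remainder at an interior point *)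

Section taylor_peano.
Context {R : realType}.
Implicit Types (g G dG : R -> R) (x y z e : R) (n k : nat).

(** A mean value theorem insensitive to the side of [x] on which [y] lies; for [y = x] the point [x]
    itself serves. *)
Lemma MVT_centered G dG x y :
  (forall z, `|z - x| <= `|y - x| -> is_derive z 1 G (dG z)) ->
  exists2 c, `|c - x| <= `|y - x| & G y - G x = dG c * (y - x).
Proof.
move=> H; have [xy|yx|xy] := ltgtP x y.
- have [z|c] := @is_derive_MVT R G dG x y xy.
    by rewrite in_itv/= => zxy; apply: H; rewrite !ger0_norm; lra.
  by rewrite in_itv/= => cxy GE; exists c => //; rewrite !ger0_norm; lra.
- have [z|c] := @is_derive_MVT R G dG y x yx.
    by rewrite in_itv/= => zxy; apply: H; rewrite !ler0_norm; lra.
  rewrite in_itv/= => cxy GE; exists c; first by rewrite !ler0_norm; lra.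
  by rewrite -opprB GE -mulrN opprB.
- by exists x; rewrite -xy !subrr ?mulr0.
Qed.

Definition taylor_poly n g x y : R :=
  \sum_(k < n.+1) derive01n k g x / k`!%:R * (y - x) ^+ k.

Lemma derive01nSr n g : derive01n n (derive01 g) = derive01n n.+1 g.
Proof. by rewrite /derive01n iterSr. Qed.

Lemma C01_derive01 n g : C01 n.+1 g -> C01 n (derive01 g).
Proof.
move=> [dg cg]; split; last by rewrite derive01nSr.
by move=> j jn x x01; rewrite derive01nSr; exact: dg.
Qed.

Lemma is_derive_taylor_poly n g x y :
  is_derive y 1 (taylor_poly n.+1 g x) (taylor_poly n (derive01 g) x y).
Proof.
rewrite (_ : taylor_poly _ _ _ = (fun z => g x) + \sum_(k < n.+1)
   (fun z => derive01n k.+1 g x / k.+1`!%:R * (z - x) ^+ k.+1)); last first.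
  apply/funext => z; rewrite /taylor_poly big_ord_recl/= fact0 divr1 expr0 mulr1.
  by rewrite fctE/= fct_sumE.
have d k : is_derive y 1 (fun z => derive01n k.+1 g x / k.+1`!%:R * (z - x) ^+ k.+1)
    (derive01n k (derive01 g) x / k`!%:R * (y - x) ^+ k).
  have d1 : is_derive y 1 (fun z => (z - x) ^+ k.+1) (k.+1%:R * (y - x) ^+ k).
    have d0 : is_derive y 1 (fun z => z - x) 1.
      by apply: is_derive_eq; rewrite subr0.
    by have := is_deriveX k.+1 d0; rewrite exprfctE/= [_ *: _]mulr1.
  apply: is_derive_eq; rewrite derive01nSr factS natrM.
  rewrite -[LHS]/(_ * (_ * _)); field.
  by rewrite nat1r !pnatr_eq0 -!lt0n fact_gt0.
have := @is_derive_sum _ _ _ n.+1 _ y 1 _ (fun k : 'I_n.+1 => d k).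
move=> ds; apply: is_derive_eq; by rewrite add0r.
Qed.

(** Induction on [n]: the derivative of the remainder of order [n + 1] of [g] is the remainder of
    order [n] of [g'], and the mean value theorem supplies one more factor [|y - x|] with the same
    [e]. *)
Lemma taylor_peano n g x : x \in `]0, 1[ -> C01 n g -> forall e, 0 < e ->
  \forall y \near x, `|g y - taylor_poly n g x y| <= e * `|y - x| ^+ n.
Proof.
move=> x01; elim: n g => [|n IH] g Cg e e0.
  have cg : {for x, continuous g} by apply: within_continuous_continuous Cg.2 x01.
  near=> y; rewrite /taylor_poly big_ord1/= fact0 divr1 !expr0 !mulr1.
  by rewrite distrC; near: y; move/cvgrPdist_le : cg; apply.
have := IH _ (C01_derive01 Cg) _ e0.
have := near_in_itvoo x01.
move=> h1 h2; 
have /nbhs_ballP[d /= d0 hd] : nbhs x (fun z => (z \in `]0, 1[) /\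
    `|derive01 g z - taylor_poly n (derive01 g) x z| <= e * `|z - x| ^+ n).
  exact: filterI h1 h2.
near=> y.
have yd : `|y - x| < d.
  by rewrite distrC; near: y; apply/nbhs_ballP; exists d => //= z; rewrite -ball_normE.
have dG z : `|z - x| <= `|y - x| ->
  is_derive z 1 (g - taylor_poly n.+1 g x)
    (derive01 g z - taylor_poly n (derive01 g) x z).
  move=> zy; have [z01 _] : (z \in `]0, 1[) /\
      `|derive01 g z - taylor_poly n (derive01 g) x z| <= e * `|z - x| ^+ n.
    by apply: hd; rewrite -ball_normE/= distrC; exact: le_lt_trans yd.
  have d1 : is_derive z 1 g (derive01 g z).
    apply: quotient01_interior => //; apply: derivable01P; apply: (Cg.1 0) => //.
    exact: subset_itv_oo_cc.
  have d2 := is_derive_taylor_poly n g x z.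
  exact: is_deriveB.
have [c cy] := MVT_centered dG.
have -> : (g - taylor_poly n.+1 g x) x = 0.
  rewrite -[LHS]/(g x - taylor_poly n.+1 g x x) /taylor_poly big_ord_recl/=.
  rewrite fact0 divr1 expr0 mulr1 big1 ?addr0 ?subrr//.
  by move=> k _; rewrite ?subrr expr0n/= mulr0.
rewrite subr0 -[(g - _) y]/(g y - taylor_poly n.+1 g x y) => ->.
rewrite normrM exprSr mulrA ler_wpM2r//.
have [_ hc] : (c \in `]0, 1[) /\
      `|derive01 g c - taylor_poly n (derive01 g) x c| <= e * `|c - x| ^+ n.
  by apply: hd; rewrite -ball_normE/= distrC; exact: le_lt_trans yd.
apply: (le_trans hc); apply: ler_wpM2l; first exact: ltW.
by rewrite lerXn2r// ?nnegrE.
Unshelve. all: by end_near. Qed.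

End taylor_peano.

(** * Kernel moments: regularity, parity, and invertibility of the moment matrix *)

Section kernels.
Context {R : realType}.
Notation mu := (@lebesgue_measure R).
Implicit Types (K phi : R -> R) (u v C : R) (k p : nat).

(** A single constant serves as bound and as Lipschitz constant, which keeps the Riemann sum
    estimates short. The function already vanishes at the endpoints -1 and 1. *)
Definition lipschitz_bump phi C : Prop :=
  [/\ 0 <= C, forall u, 1 <= `|u| -> phi u = 0, forall u, `|phi u| <= C &
      forall u v, `|phi u - phi v| <= C * `|u - v|].

Definition moment_fun K k u : R := u ^+ k * K u.

(** The support condition settles [u > 1]; the Lipschitz estimate between 1 and [1 + e / L] reaches
    the endpoint 1, and symmetry gives the negative side. *)
Lemma kernel_density_eq0 K u : kernel_density K -> 1 <= `|u| -> K u = 0.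
Proof.
move=> [/pinfty_ex_gt0[L L0 lK] symK _ _ supp].
have K0 v : 1 < v -> K v = 0.
  move=> v1; apply: contrapT => /eqP Kv.
  have : `[(-1 : R), 1]%classic v by rewrite -supp; exact: subset_closure.
  by rewrite /= in_itv/= => /andP[_]; rewrite leNgt v1.
have K1 : K 1 = 0.
  apply/eqP; rewrite -normr_le0; apply/ler_addgt0Pr => e e0; rewrite add0r.
  have := lK (1, 1 + e / L) (conj I I); rewrite /=.
  rewrite (K0 (1 + e / L)) ?subr0; last by rewrite ltrDl divr_gt0.
  move=> /le_trans; apply.
  by rewrite opprD addNKr normrN gtr0_norm ?divr_gt0// mulrCA divff ?gt_eqF// mulr1.
have K0' v : 1 <= v -> K v = 0 by rewrite le_eqVlt => /predU1P[<-//|/K0].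
have [u0|u0] := leP 0 u; first by rewrite ger0_norm//; exact: K0'.
by rewrite ltr0_norm// -symK; exact: K0'.
Qed.

Lemma kernel_density_bump K : kernel_density K -> exists C, lipschitz_bump K C.
Proof.
move=> hK; have K0 u := @kernel_density_eq0 K u hK.
have [/pinfty_ex_gt0[L L0 lK] _ _ _ _] := hK.
have {}lK u v : `|K u - K v| <= L * `|u - v| by exact: (lK (u, v) (conj I I)).
(* For [|u| < 1] the value [K u] is compared with [K 2 = 0], at distance at most 3. *)
exists (L * 3); split=> [|//|u|u v].
- by rewrite mulr_ge0// ltW.
- have [/K0 ->|u1] := leP 1 `|u|; first by rewrite normr0 mulr_ge0// ltW.
  have K2 : K 2 = 0 by apply: K0; rewrite ger0_norm// ler1n.
  have := lK u 2; rewrite K2 subr0.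
  move=> /le_trans; apply; rewrite ler_wpM2l ?(ltW L0)//.
  apply: (le_trans (ler_normB _ _)); rewrite (@ger0_norm _ 2)//; lra.
- apply: (le_trans (lK u v)); rewrite -mulrA ler_wpM2l ?(ltW L0)//.
  by rewrite ler_peMl// ler1n.
Qed.

(** If [|a| <= 1], both summands of [a * (phi a - phi b) + phi b * (a - b)] are at most
    [C * |a - b|]. By symmetry this covers every pair except two points outside [-1, 1], where the
    function vanishes. *)
Lemma lipschitz_bump_mulid phi C : lipschitz_bump phi C ->
  lipschitz_bump (fun u => u * phi u) (C + C).
Proof.
move=> [C0 phi0 phiC lphi]; split=> [|u u1|u|u v].
- by rewrite addr_ge0.
- by rewrite phi0// mulr0.
- have [/phi0 ->|u1] := leP 1 `|u|; first by rewrite mulr0 normr0 addr_ge0.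
  rewrite normrM (le_trans (_ : _ <= 1 * C))//; last by rewrite mul1r lerDl.
  by rewrite ler_pM// ltW.
have main a b : `|a| <= 1 -> `|a * phi a - b * phi b| <= (C + C) * `|a - b|.
  move=> a1; have -> : a * phi a - b * phi b = a * (phi a - phi b) + phi b * (a - b).
    by ring.
  apply: (le_trans (ler_normD _ _)); rewrite mulrDl lerD// normrM.
    by rewrite -[leRHS]mul1r ler_pM.
  by rewrite ler_wpM2r.
have [u1|/ltW u1] := leP `|u| 1; first exact: main.
have [v1|/ltW v1] := leP `|v| 1; first by rewrite distrC [`|u - v|]distrC; exact: main.
by rewrite !phi0// !mulr0 subrr normr0 mulr_ge0// addr_ge0.
Qed.

Lemma moment_fun_bump K k : kernel_density K ->
  exists C, lipschitz_bump (moment_fun K k) C.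
Proof.
move=> /kernel_density_bump hK; elim: k => [|k [C /lipschitz_bump_mulid hC]].
  by have [C hC] := hK; exists C; rewrite /moment_fun; under eq_fun do rewrite expr0 mul1r.
exists (C + C); move: hC; congr lipschitz_bump.
by apply/funext => u; rewrite /moment_fun exprS mulrA.
Qed.

Lemma lipschitz_bump_continuous phi C : lipschitz_bump phi C -> continuous phi.
Proof.
move=> [C0 _ _ lphi] u; apply/cvgrPdist_le => e e0.
have C1 : 0 < C + 1 by rewrite ltr_wpDl.
near=> v; apply: (le_trans (lphi _ _)).
apply: (@le_trans _ _ ((C + 1) * `|u - v|)); first by rewrite ler_wpM2r// lerDl.
rewrite mulrC -ler_pdivlMr//; near: v.
by have /cvgrPdist_le := @cvg_id _ (nbhs u); apply; rewrite divr_gt0.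
Unshelve. all: by end_near. Qed.

Lemma moment_fun_continuous K k : kernel_density K -> continuous (moment_fun K k).
Proof.
by move=> /(moment_fun_bump k)[C]; exact: lipschitz_bump_continuous.
Qed.

(** For a primitive [G] of the odd function [u^k K(u)], the difference [G u - G (- u)] has zero
    derivative and vanishes at 0; its value at 1 is the moment. *)
Lemma mu_odd_eq0 K k : kernel_density K -> odd k -> mu_ K k = 0.
Proof.
move=> hK oddk; rewrite /mu_ -/(moment_fun K k).
have [G [dG ->]] := @continuous_primitive R (moment_fun K k) (- 2) (@moment_fun_continuous K k hK);
  [|lra|lra].
have dE u : u \in `[0, 1] -> is_derive u 1 (fun u => G u - G (- u)) ((fun=> 0) u).
  rewrite in_itv/= => u01.
  have d1 : is_derive u 1 G (moment_fun K k u) by apply: dG; lra.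
  have d2 : is_derive (- u) 1 G (moment_fun K k (- u)) by apply: dG; lra.
  have d3 : is_derive u 1 (fun u : R => - u) (- 1) by exact: is_derive_eq.
  have d4 := is_derive1_comp d2 d3.
  have := is_deriveB d1 d4; have [_ symK _ _ _] := hK.
  rewrite /moment_fun symK exprNn -signr_odd oddk expr1 mulN1r mulrN mulr1.
  by rewrite mulNr opprK subrr.
have [] := is_derive_MVT (@ltr01 R) dE.
by move=> u _; rewrite oppr0 subrr subr0 mul0r.
Qed.

Lemma kernel_density_neq0 K : kernel_density K ->
  exists2 u, u \in `]-1, 1[ & 0 < K u.
Proof.
move=> hK; apply: contrapT => h.
have [_ _ K0 + _] := hK.
rewrite (_ : K = cst 0).
  rewrite Rintegral_cst//= mul0r => /esym/eqP; by rewrite oner_eq0.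
apply/funext => u /=; have [u1|] := ltP `|u| 1; last exact: kernel_density_eq0.
apply/eqP/negPn/negP => Ku; apply: h; exists u; last by rewrite lt_neqAle eq_sym Ku K0.
by rewrite in_itv/= -ltr_norml.
Qed.

Lemma continuous_lincomb (I : Type) (r : seq I) (c : I -> R) (f : I -> R -> R) :
  (forall i, continuous (f i)) -> continuous (fun u => \sum_(i <- r) c i * f i u).
Proof.
move=> cf u; elim: r => [|i r IH].
  by under eq_fun do rewrite big_nil; exact: cvg_cst.
under eq_fun do rewrite big_cons.
by apply: cvgD => //; apply: cvgM; [exact: cvg_cst|exact: cf].
Qed.

Lemma Rintegral_lincomb (I : Type) (r : seq I) (c : I -> R) (f : I -> R -> R) a b :
  (forall i, continuous (f i)) ->
  \int[mu]_(u in `[a, b]) (\sum_(i <- r) c i * f i u) =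
  \sum_(i <- r) c i * \int[mu]_(u in `[a, b]) f i u.
Proof.
move=> cf; elim: r => [|i r IH].
  rewrite big_nil; under eq_Rintegral do rewrite big_nil.
  by rewrite Rintegral_cst//= mul0r.
rewrite big_cons -IH -RintegralZl//; last exact: continuous_integrable.
rewrite -RintegralD//; first by apply: eq_Rintegral => u _; rewrite big_cons.
- apply: continuous_integrable => u.
  by apply: cvgM; [exact: cvg_cst|exact: cf].
- apply: continuous_integrable; exact: continuous_lincomb.
Qed.

(** A nonzero [q] has fewer than [size q] roots, whereas [s] lists [size q] distinct ones inside the
    neighbourhood. *)
Lemma poly_eq0_near (q : {poly R}) u : (\forall v \near u, q.[v] = 0) -> q = 0.
Proof.
move=> /nbhs_ballP[e /= e0 qe]; apply/eqP; apply: contraT => q0.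
pose s := [seq u + e * (i%:R / (size q).+1%:R) | i <- iota 0 (size q)].
have : (size s < size q)%N.
  apply: max_poly_roots q0 _ _.
    apply/allP => _ /mapP[i + ->]; rewrite mem_iota/= add0n => iq.
    rewrite /root; apply/eqP/qe; rewrite -ball_normE/= opprD addNKr normrN.
    rewrite normrM (ger0_norm (ltW e0)) ger0_norm ?divr_ge0//.
    by rewrite -[ltRHS]mulr1 ltr_pM2l// ltr_pdivrMr// mul1r ltr_nat ltnW.
  rewrite map_inj_uniq ?iota_uniq// => i j /addrI /(mulfI (lt0r_neq0 e0)).
  by move=> /mulIf; rewrite invr_eq0 pnatr_eq0 => /(_ isT) /eqP; rewrite eqr_nat => /eqP.
by rewrite size_map size_iota ltnn.
Qed.

(** This is a Gram matrix: [v S v'] is the integral of [q^2 K], where [q] has coefficient vector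
    [v]. If [v S = 0], then [q^2 K] vanishes on (-1, 1), so [q] vanishes near a point where [K] is
    positive. *)
Lemma matS_unit p K : kernel_density K -> matS p K \in unitmx.
Proof.
move=> hK; rewrite unitmxE unitfE; apply/negP => /det0P[v v0 vS].
pose q := rVpoly v.
have qE u : q.[u] = \sum_(k < p.+1) v 0 k * u ^+ k.
  by rewrite horner_poly; apply: eq_bigr => i _; rewrite valK.
have int0 : \int[mu]_(u in `[-1, 1]) (q.[u] ^+ 2 * K u) = 0.
  have -> : 0 = (v *m matS p K *m v^T) 0 0 by rewrite vS mul0mx mxE.
  rewrite mxE.
  transitivity (\sum_(k < p.+1) v 0 k *
      \int[mu]_(u in `[-1, 1]) (\sum_(l < p.+1) v 0 l * moment_fun K (l + k) u)).
    rewrite -Rintegral_lincomb; last first.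
      by move=> k; apply: continuous_lincomb => l; exact: moment_fun_continuous.
    apply: eq_Rintegral => u _; rewrite expr2 -mulrA {1}qE mulr_suml.
    apply: eq_bigr => k _; rewrite qE -!mulrA; congr (_ * _).
    rewrite mulr_suml mulr_sumr; apply: eq_bigr => l _.
    by rewrite /moment_fun exprD; ring.
  apply: eq_bigr => k _; rewrite !mxE mulrC; congr (_ * _).
  rewrite Rintegral_lincomb; last by move=> l; exact: moment_fun_continuous.
  by apply: eq_bigr => l _; rewrite !mxE.
have [u u11 Ku] := kernel_density_neq0 hK.
have cK : continuous K.
  by have [C /lipschitz_bump_continuous] := kernel_density_bump hK.
have [_ _ K0 _ _] := hK.
have q0 w : w \in `]-1, 1[ -> q.[w] ^+ 2 * K w = 0.
  apply: ge0_continuous_Rintegral_eq0 int0 w.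
    move=> w; apply: cvgM; last exact: cK.
    by rewrite -[X in _ --> X]/(q.[w] ^+ 2); apply: cvgM; exact: continuous_horner.
  by move=> w _; rewrite mulr_ge0// sqr_ge0.
suff : q = 0.
  move=> /(congr1 (@poly_rV _ p.+1)); rewrite rVpolyK linear0 => /eqP.
  by rewrite (negbTE v0).
apply: (@poly_eq0_near _ u); near=> w.
have Kw : K w != 0.
  have : 0 < K w by near: w; move/cvgr_gt : (cK u); apply.
  by move=> /lt0r_neq0.
have : w \in `]-1, 1[ by near: w; exact: near_in_itvoo.
by move=> /q0 /eqP; rewrite mulf_eq0 (negbTE Kw) orbF sqrf_eq0 => /eqP.
Unshelve. all: by end_near. Qed.

End kernels.

(** * Kernel sums over the design points as Riemann sums, with explicit error bounds *)

Section riemann_sums_over_the_design.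
Context {R : realType}.
Notation mu := (@lebesgue_measure R).
Implicit Types (f phi G : R -> R) (xs : nat -> R) (x h C D e a u v w t : R) (N : nat).

(** The distribution function [F] is strictly increasing, which fixes the extreme nodes and orders
    the others; the mean value theorem for [F] on a cell yields [z]. *)
Lemma design_nodes f N xs : {within `[0, 1], continuous f} -> density01 f ->
  (1 < N)%N -> is_design f N xs ->
  [/\ xs 0%N = 0, xs N.-1 = 1 & forall j, (j < N.-1)%N ->
    exists2 z, xs j < z < xs j.+1 & f z * (xs j.+1 - xs j) = N.-1%:R^-1].
Proof.
move=> cf [f0 f1] N1 hxs.
have [F [cF dF F0 FE]] := primitive01 cf.
have N0 : (0 < N)%N by exact: ltn_trans N1.
have M0 : 0 < N.-1%:R :> R by rewrite ltr0n -ltnS prednK.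
have F1 : F 1 = 1 by rewrite -FE// in_itv/= ler01 lexx.
have Fmvt y z : 0 <= y -> y < z -> z <= 1 ->
    exists2 c, y < c < z & F z - F y = f c * (z - y).
  move=> y0 yz z1.
  have dF' c : c \in `]y, z[ -> is_derive c 1 F (f c).
    rewrite in_itv/= => /andP[yc cz]; apply: dF; rewrite in_itv/=.
    by rewrite (le_lt_trans y0)//= (lt_le_trans cz).
  have cF' : {within `[y, z], continuous F}.
    by apply: continuous_subspaceW cF; apply: subset_itv; rewrite bnd_simp.
  by have [c] := MVT yz dF' cF'; rewrite in_itv/=; exists c.
have Finc y z : 0 <= y -> y < z -> z <= 1 -> F y < F z.
  move=> y0 yz z1; have [c /andP[yc cz] FF] := Fmvt y z y0 yz z1.
  rewrite -subr_gt0 FF mulr_gt0 ?subr_gt0//; apply: f0; rewrite in_itv/=.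
  by apply/andP; split; [exact: le_trans y0 (ltW yc)|exact: le_trans (ltW cz) z1].
have xsE j : (j < N)%N -> [/\ 0 <= xs j, xs j <= 1 & F (xs j) = j%:R / N.-1%:R].
  move=> /hxs[xs01 FF]; rewrite -FE//.
  by move: xs01; rewrite in_itv/= => /andP[? ?]; split.
split.
- have [x0 x1 Fx] := xsE _ N0; apply/eqP; rewrite eq_le x0 andbT leNgt.
  by apply/negP => /(Finc _ _ (lexx 0))/(_ x1); rewrite F0 Fx mul0r ltxx.
- have [|x0 x1 Fx] := xsE N.-1; first by rewrite prednK.
  apply/eqP; rewrite eq_le x1/= leNgt.
  apply/negP => /(Finc _ _ x0)/(_ (lexx 1)).
  by rewrite F1 Fx divff ?gt_eqF// ltxx.
- move=> j jN.
  have jN1 : (j.+1 < N)%N by rewrite -(prednK N0) ltnS.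
  have [x0 x1 Fx] := xsE _ (ltnW jN1); have [y0 y1 Fy] := xsE _ jN1.
  have Fxy : F (xs j.+1) - F (xs j) = N.-1%:R^-1.
    by rewrite Fx Fy -mulrBl -natr1 addrAC subrr add0r mul1r.
  have xy : xs j < xs j.+1.
    rewrite ltNge; apply/negP; rewrite le_eqVlt => /predU1P[E|/(Finc _ _ y0)/(_ x1)].
      by move: Fxy; rewrite E subrr => /esym/eqP; rewrite invr_eq0 gt_eqF.
    by rewrite -subr_lt0 Fxy invr_lt0 ltNge ltW.
  by have [c cxy cE] := Fmvt _ _ x0 xy y1; exists c => //; rewrite -cE.
Qed.

(** As [G] is constant beyond [-1, 1], telescoping its increments over nodes that overshoot the
    support gives exactly the integral. *)
Lemma bump_primitive phi C a : lipschitz_bump phi C -> a < -1 ->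
  exists G : R -> R, [/\
    forall u v, a < u -> u < v ->
      exists2 w, u < w < v & G v - G u = phi w * (v - u),
    forall u, a < u -> u <= -1 -> G u = G (-1),
    forall u, 1 <= u -> G u = G 1 &
    G 1 - G (-1) = \int[mu]_(u in `[-1, 1]) phi u].
Proof.
move=> hphi a1; have cphi := lipschitz_bump_continuous hphi.
have [_ phi0 _ _] := hphi.
have [G [dG GE]] := @continuous_primitive R phi a cphi.
have mvt u v : a < u -> u < v ->
    exists2 w, u < w < v & G v - G u = phi w * (v - u).
  move=> au uv; have [w|w] := @is_derive_MVT R G phi u v uv.
    by rewrite in_itv/= => /andP[uw _]; apply: dG; exact: lt_le_trans uw.
  by rewrite in_itv/=; exists w.
exists G; split => //.
- move=> u au; rewrite le_eqVlt => /predU1P[->//|u1].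
  have [w /andP[_ w1]] := mvt _ _ au u1.
  rewrite phi0; last by rewrite ler0_norm; lra.
  by rewrite mul0r => /eqP; rewrite subr_eq0 => /eqP.
- move=> u; rewrite le_eqVlt => /predU1P[->//|u1].
  have [|w /andP[w1 _]] := mvt _ _ _ u1; first by lra.
  rewrite phi0; last by rewrite ger0_norm; lra.
  by rewrite mul0r => /eqP; rewrite subr_eq0 => /eqP.
- by rewrite GE//; lra.
Qed.

(* The errors of the Riemann sum are bounded by multiples of the increments of
   [clamp2], which telescope to at most 4 however many cells there are. *)
Definition clamp2 t : R := Num.max (- 2) (Num.min 2 t).

Lemma clamp2_homo : {homo clamp2 : s t / s <= t}.
Proof.
move=> s t st; rewrite /clamp2 ge_max le_max lexx/= le_max; apply/orP; right.
by rewrite le_min !ge_min lexx st orbT.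
Qed.

Lemma clamp2_id t : - 2 <= t <= 2 -> clamp2 t = t.
Proof. by move=> /andP[t2 t2']; rewrite /clamp2 min_r// max_r. Qed.

Lemma clamp2_bound t : - 2 <= clamp2 t <= 2.
Proof.
rewrite /clamp2 le_max lexx/= ge_max ge_min lexx/= andbT.
by rewrite -subr_ge0 opprK addr_ge0.
Qed.

(* [fw] is the density at the mean value point of the cell, [w] its rescaled
   position, and [w0], [w1] are the mean value points of primitives of [phi] and
   of [u * phi u]. *)
Lemma bump_cell_error phi C h e D u v w w0 w1 fw fx dfx :
  lipschitz_bump phi C -> 0 < h -> h <= 1 -> 0 < e -> D <= 1 -> D <= e * h ->
  u < v -> v - u <= D -> u < w < v -> u < w0 < v -> u < w1 < v ->
  (`|w| <= 2 -> `|fw - fx - dfx * (h * w)| <= e * (2 * h)) ->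
  `|phi u * (fw * (v - u)) - (fx * (phi w0 * (v - u)) +
      h * dfx * (w1 * phi w1 * (v - u)))| <=
    e * h * (C * (2 + `|fx| + 3 * `|dfx|)) * (clamp2 v - clamp2 u).
Proof.
move=> hphi h0 h1 e0 D1 De uv vuD /andP[uw wv] /andP[uw0 w0v] /andP[uw1 w1v] hw.
have [C0 phi0 phiC phiL] := hphi; have [_ _ _ phi1L] := lipschitz_bump_mulid hphi.
have cuv : 0 <= clamp2 v - clamp2 u by rewrite subr_ge0 clamp2_homo// ltW.
have eh0 : 0 < e * h by rewrite mulr_gt0.
have B0 : 0 <= 2 + `|fx| + 3 * `|dfx| by rewrite !addr_ge0// mulr_ge0.
have rhs0 : 0 <= e * h * (C * (2 + `|fx| + 3 * `|dfx|)) * (clamp2 v - clamp2 u).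
  by rewrite mulr_ge0// mulr_ge0 ?(ltW eh0)// mulr_ge0.
have [v1|v1] := leP v (-1).
  rewrite !phi0; [|rewrite ler0_norm; lra..].
  by rewrite !(mul0r, mulr0) addr0 subrr normr0.
have [u1|u1] := leP 1 u.
  rewrite !phi0; [|rewrite ger0_norm; lra..].
  by rewrite !(mul0r, mulr0) addr0 subrr normr0.
(* The remaining cells meet (-1, 1) and have length at most 1, so they lie in [-2, 2]. *)
rewrite !clamp2_id; [|lra..].
(* The three summands are the expansion error of the density, the variation of [phi] over the cell,
   and the errors in the term of first order in [h]. *)
have -> : phi u * (fw * (v - u)) - (fx * (phi w0 * (v - u)) +
      h * dfx * (w1 * phi w1 * (v - u))) =
   (phi u * (fw - fx - dfx * (h * w)) + fx * (phi u - phi w0)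
    + h * dfx * (phi u * (w - u) + (u * phi u - w1 * phi w1))) * (v - u) by ring.
have vu0 : 0 <= v - u by lra.
rewrite normrM (ger0_norm vu0) ler_wpM2r//.
have b1 : `|phi u * (fw - fx - dfx * (h * w))| <= C * (e * (2 * h)).
  by rewrite normrM ler_pM// hw// ler_norml; lra.
have b2 : `|fx * (phi u - phi w0)| <= `|fx| * (C * (e * h)).
  rewrite normrM ler_wpM2l//; apply: (le_trans (phiL _ _)); apply: ler_wpM2l => //.
  by rewrite ler0_norm; lra.
have b3 : `|phi u * (w - u) + (u * phi u - w1 * phi w1)| <= C * (e * h) + (C + C) * (e * h).
  apply: (le_trans (ler_normD _ _)); apply: lerD.
    by rewrite normrM ler_pM// ger0_norm; lra.
  apply: (le_trans (phi1L _ _)); apply: ler_wpM2l; first by rewrite addr_ge0.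
  by rewrite ler0_norm; lra.
have b4 : `|h * dfx * (phi u * (w - u) + (u * phi u - w1 * phi w1))| <=
    `|dfx| * (C * (e * h) + (C + C) * (e * h)).
  rewrite normrM ler_pM// normrM (ger0_norm (ltW h0)).
  by rewrite -[leRHS]mul1r ler_wpM2r.
have -> : e * h * (C * (2 + `|fx| + 3 * `|dfx|)) =
  C * (e * (2 * h)) + `|fx| * (C * (e * h)) + `|dfx| * (C * (e * h) + (C + C) * (e * h)).
  by ring.
apply: (le_trans (ler_normD _ _)); apply: lerD => //.
by apply: (le_trans (ler_normD _ _)); apply: lerD.
Qed.

(** The factor [N.-1] is the number of cells, each of mass [1 / (N - 1)], while the sum runs over
    all [N] nodes. *)
Definition design_mean N xs x h phi : R :=
  (N.-1%:R * h)^-1 * \sum_(j < N) phi ((xs j - x) / h).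

(** Both integrals are telescoping sums of increments of primitives over the rescaled nodes, so the
    error splits into cell errors. The factor 4 bounds the total increment of [clamp2]. *)
Lemma design_mean_expansion phi C f N xs x h e D dfx :
  lipschitz_bump phi C -> 0 < h -> h <= 1 -> h < x -> h <= 1 - x ->
  0 < e -> D <= 1 -> D <= e * h -> (1 < N)%N ->
  xs 0%N = 0 -> xs N.-1 = 1 ->
  (forall j, (j < N.-1)%N ->
    exists2 z, xs j < z < xs j.+1 & f z * (xs j.+1 - xs j) = N.-1%:R^-1) ->
  (forall j, (j < N.-1)%N -> xs j.+1 - xs j <= D * h) ->
  (forall z, `|z - x| <= 2 * h -> `|f z - f x - dfx * (z - x)| <= e * (2 * h)) ->
  `|design_mean N xs x h phi -
      (f x * \int[mu]_(u in `[-1, 1]) phi u +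
       h * dfx * \int[mu]_(u in `[-1, 1]) (u * phi u))| <=
    4 * (e * h * (C * (2 + `|f x| + 3 * `|dfx|))).
Proof.
move=> hphi h0 h1 hx hx1 e0 D1 De N1 xs0 xsN hxs gap hf.
have hh : h != 0 by rewrite gt_eqF.
case: N N1 xsN hxs gap => [//|M] M0 /= xsM hxs gap.
have M0' : M%:R != 0 :> R by rewrite pnatr_eq0 -lt0n.
pose u j := (xs j - x) / h.
(* A base point strictly to the left of all rescaled nodes. *)
pose a := u 0%N - 1.
have u0 : u 0%N < -1.
  by rewrite /u xs0 sub0r ltr_pdivrMr//; lra.
have uM : 1 <= u M by rewrite /u xsM ler_pdivlMr//; lra.
have xsE j : xs j = x + h * u j by rewrite /u; field.
have uinc j : (j < M)%N -> u j < u j.+1.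
  move=> /hxs[z /andP[xz zx] _].
  by rewrite /u ltr_pM2r ?invr_gt0//; lra.
have ua j : (j <= M)%N -> u 0%N <= u j.
  elim: j => [//|j IH] jM; exact: le_trans (IH (ltnW jM)) (ltW (uinc _ jM)).
have au j : (j <= M)%N -> a < u j by move=> /ua; rewrite /a; lra.
have a1 : a < -1 by rewrite /a; lra.
have [G0 [mvt0 G0l G0r <-]] := bump_primitive hphi a1.
have [G1 [mvt1 G1l G1r <-]] := bump_primitive (lipschitz_bump_mulid hphi) a1.
rewrite -(G0l (u 0%N)) ?(au 0%N)//; last exact: ltW.
rewrite -(G1l (u 0%N)) ?(au 0%N)//; last exact: ltW.
rewrite -(G0r (u M))// -(G1r (u M))//.
(* The last of the [M + 1] nodes lies beyond the support, which leaves one term per cell, taken at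
   its left end. *)
have phiM : phi (u M) = 0.
  by have [_ p0 _ _] := hphi; apply: p0; rewrite ger0_norm//; lra.
rewrite /design_mean big_ord_recr/= -/(u M) phiM addr0.
rewrite -(big_mkord xpredT (fun j => phi (u j))) mulr_sumr.
rewrite -(telescope_sumr (fun j => G0 (u j)) (leq0n M)).
rewrite -(telescope_sumr (fun j => G1 (u j)) (leq0n M)).
rewrite !mulr_sumr -big_split/= -sumrB.
apply: (le_trans (ler_norm_sum _ _ _)).
set B := e * h * _.
have B0 : 0 <= B.
  have [C0 _ _ _] := hphi.
  by rewrite /B !mulr_ge0 ?addr_ge0 ?(ltW e0) ?(ltW h0)// mulr_ge0.
apply: (@le_trans _ _ (\sum_(0 <= j < M) B * (clamp2 (u j.+1) - clamp2 (u j)))).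
  rewrite big_seq [leRHS]big_seq; apply: ler_sum => j.
  rewrite mem_index_iota/= => jM.
  have [z /andP[xz zx] fz] := hxs _ jM.
  have [w0 hw0 ->] := mvt0 _ _ (au _ (ltnW jM)) (uinc _ jM).
  have [w1 hw1 ->] := mvt1 _ _ (au _ (ltnW jM)) (uinc _ jM).
  (* The mass [1 / M] of the cell is the density at [z] times the length [h * (u j.+1 - u j)]. *)
  have -> : (M%:R * h)^-1 * phi (u j) = phi (u j) * (f z * (u j.+1 - u j)).
    rewrite invfM -fz /u; field.
    exact: hh.
  apply: (@bump_cell_error phi C h e D _ _ ((z - x) / h)) => //.
  - exact: uinc.
  - by rewrite -(ler_pM2r h0) mulrBl !divfK//; have := gap _ jM; lra.
  - by rewrite !ltr_pM2r ?invr_gt0//; lra.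
  - move=> hz; rewrite [h * _]mulrC divfK//; apply: hf.
    by move: hz; rewrite normrM normfV (gtr0_norm h0) ler_pdivrMr.
rewrite -mulr_sumr (telescope_sumr (fun j => clamp2 (u j)) (leq0n M)) mulrC ler_wpM2r//.
have := clamp2_bound (u M); have := clamp2_bound (u 0%N); lra.
Qed.

End riemann_sums_over_the_design.

(** * First-order expansion of the design means as the bandwidth tends to 0 *)

Section asymptotics_of_design_means.
Context {R : realType} {T : Type} (F : set_system T) {FF : ProperFilter F}.
Notation mu := (@lebesgue_measure R).
Variables (f : R -> R) (x : R) (h : T -> R) (N : T -> nat) (xs : nat -> nat -> R).
Hypothesis Cf : C01 1 f.
Hypothesis df : density01 f.
Hypothesis x01 : x \in `]0, 1[.
Hypothesis h_gt0 : forall t, 0 < h t.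
Hypothesis h0 : h t @[t --> F] --> (0 : R).
Hypothesis Nh : ((N t)%:R * h t ^+ 2 : R) @[t --> F] --> +oo.
Hypothesis hxs : forall M, (1 < M)%N -> is_design f M (xs M).

Lemma bandwidth_lt e : 0 < e -> \forall t \near F, h t < e.
Proof. by move=> e0; move/cvgr_lt : h0; apply. Qed.

Lemma sample_size_gt1 : \forall t \near F, (1 < N t)%N.
Proof.
near=> t; rewrite -(@ltr_nat R).
have h1 : h t < 1 by near: t; apply: bandwidth_lt.
have : 1 < (N t)%:R * h t ^+ 2 by near: t; move/cvgryPgt : Nh; apply.
move=> /lt_le_trans; apply; rewrite -[leRHS]mulr1 ler_wpM2l//.
by rewrite expr_le1 ?ltW.
Unshelve. all: by end_near. Qed.

Lemma design_mean_near phi C e : lipschitz_bump phi C -> 0 < e ->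
  \forall t \near F, `|design_mean (N t) (xs (N t)) x (h t) phi -
      (f x * \int[mu]_(u in `[-1, 1]) phi u +
       h t * derive01 f x * \int[mu]_(u in `[-1, 1]) (u * phi u))| <= e * h t.
Proof.
move=> hphi e0; have [C0 _ _ _] := hphi.
have cf : {within `[0, 1], continuous f} := C01_continuous Cf (leqnSn 0).
have [z0 z01 fmin] := EVT_min (@ler01 R) cf.
have f00 : 0 < f z0 by exact: df.1.
have /andP[x0 x1] : 0 < x < 1 by move: x01; rewrite in_itv.
pose B := C * (2 + `|f x| + 3 * `|derive01 f x|).
have B0 : 0 <= B by rewrite mulr_ge0// !addr_ge0// mulr_ge0.
(* Chosen so that [4 * e' * B <= e]; the added 1 keeps the denominator positive when [B = 0]. *)
pose e' := e / (4 * (B + 1)).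
have e'0 : 0 < e' by rewrite divr_gt0// mulr_gt0// ltr_wpDl.
have /nbhs_ballP[r /= r0 hr] := taylor_peano x01 Cf e'0.
near=> t.
have ht := h_gt0 t.
have N1 : (1 < N t)%N by near: t; exact: sample_size_gt1.
have h1 : h t <= 1 by apply/ltW; near: t; exact: bandwidth_lt.
have hx : h t < x by near: t; exact: bandwidth_lt.
have hx1 : h t <= 1 - x by apply/ltW; near: t; apply: bandwidth_lt; rewrite subr_gt0.
have hr2 : h t < r / 2 by near: t; apply: bandwidth_lt; rewrite divr_gt0.
have he' : h t < e'^-1 by near: t; apply: bandwidth_lt; rewrite invr_gt0.
(* Since [N <= 2 * (N - 1)], this threshold yields [D <= e' * h] below. *)
have Nbig : 2 / (f z0 * e') < (N t)%:R * h t ^+ 2.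
  by near: t; move/cvgryPgt : Nh; apply.
have [xs0 xsN xsS] := design_nodes cf df N1 (hxs N1).
pose M : R := (N t).-1%:R.
have M0 : 0 < M by rewrite /M ltr0n -ltnS prednK// (ltn_trans _ N1).
have NM : (N t)%:R <= 2 * M.
  rewrite /M -natrM ler_nat; case: (N t) N1 => [//|[//|n]] _ /=.
  by rewrite mul2n -addnn addnS ltnS leq_addr.
(* [f z0] is the minimum of [f], so no cell is longer than [1 / (f z0 * M)], that is, [D * h]. *)
pose D := (f z0 * M * h t)^-1.
have De : D <= e' * h t.
  rewrite /D -div1r ler_pdivrMr ?mulr_gt0//.
  move: Nbig; rewrite ltr_pdivrMr ?(mulr_gt0 f00 e'0)// => {}Nbig.
  have : (N t)%:R * h t ^+ 2 * (f z0 * e') <= 2 * M * h t ^+ 2 * (f z0 * e').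
    by rewrite (ler_wpM2r (ltW (mulr_gt0 f00 e'0)))// ler_wpM2r// sqr_ge0.
  rewrite expr2 => Nle; have := lt_le_trans Nbig Nle; lra.
have D1 : D <= 1.
  apply: (le_trans De); rewrite -(divff (lt0r_neq0 e'0)) ler_wpM2l//; exact: ltW.
have xs01 j : (j <= (N t).-1)%N -> 0 <= xs (N t) j <= 1.
  move=> jN; have [|] := hxs N1 (j := j); last by rewrite in_itv.
  by rewrite -(prednK (ltnW N1)) ltnS.
apply: (le_trans (@design_mean_expansion R phi C f (N t) (xs (N t)) x (h t) e' D
  (derive01 f x) hphi ht h1 hx hx1 e'0 D1 De N1 xs0 xsN xsS _ _)).
- move=> j jN; have [z /andP[xz zx] fz] := xsS _ jN.
  have /andP[a0 a1] := xs01 _ (ltnW jN); have /andP[b0 b1] := xs01 _ jN.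
  have fzz : f z0 <= f z by apply: fmin; rewrite in_itv/=; lra.
  rewrite /D invfM divfK ?gt_eqF// invfM -[leRHS]mulrC -ler_pdivrMr ?invr_gt0//.
  rewrite invrK mulrC -fz ler_wpM2r//; lra.
- move=> z zx; have zr : ball x r z.
    by rewrite -ball_normE/= distrC (le_lt_trans zx)//; lra.
  have := hr _ zr; rewrite /taylor_poly !big_ord_recl big_ord0/= /bump/=.
  rewrite fact0 !divr1 expr0 mulr1 addr0 expr1 opprD addrA => /le_trans; apply.
  by rewrite ler_wpM2l// ltW.
- rewrite -/B [4 * _](_ : _ = (4 * (e' * B)) * h t); last by ring.
  rewrite ler_wpM2r ?(ltW ht)// /e' (_ : 4 * _ = e * (B / (B + 1))); last first.
    by field; rewrite gt_eqF// ltr_wpDl.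
  by rewrite -[leRHS]mulr1 ler_wpM2l ?(ltW e0)// ler_pdivrMr ?mul1r ?lerDl// ltr_wpDl.
Unshelve. all: by end_near. Qed.

Lemma design_mean_cvg phi C : lipschitz_bump phi C ->
  design_mean (N t) (xs (N t)) x (h t) phi @[t --> F] -->
    f x * \int[mu]_(u in `[-1, 1]) phi u.
Proof.
move=> hphi; set I0 := f x * _; set I1 := \int[mu]_(u in `[-1, 1]) (u * phi u).
have c1 : h t * derive01 f x * I1 @[t --> F] --> (0 : R).
  rewrite -(mul0r I1) -(mul0r (derive01 f x)).
  by apply: cvgM; [apply: cvgM => //|]; exact: cvg_cst.
have c2 : (design_mean (N t) (xs (N t)) x (h t) phi - (I0 + h t * derive01 f x * I1))
    @[t --> F] --> (0 : R).
  apply/cvgr0Pnorm_le => e e0; near=> t.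
  have : `|design_mean (N t) (xs (N t)) x (h t) phi - (I0 + h t * derive01 f x * I1)|
    <= e * h t by near: t; exact: (design_mean_near hphi).
  move=> /le_trans; apply; rewrite -[leRHS]mulr1 ler_wpM2l//; first exact: ltW.
  by apply/ltW; near: t; exact: bandwidth_lt.
have : (design_mean (N t) (xs (N t)) x (h t) phi - (I0 + h t * derive01 f x * I1)
   + (I0 + h t * derive01 f x * I1)) @[t --> F] --> 0 + (I0 + 0).
  by apply: cvgD => //; apply: cvgD => //; exact: cvg_cst.
rewrite add0r addr0; apply: cvg_trans; apply: near_eq_cvg; near=> t.
by rewrite subrK.
Unshelve. all: by end_near. Qed.

Lemma design_mean_cvg_rate phi C : lipschitz_bump phi C ->
  (design_mean (N t) (xs (N t)) x (h t) phi - f x * \int[mu]_(u in `[-1, 1]) phi u)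
    / h t @[t --> F] --> derive01 f x * \int[mu]_(u in `[-1, 1]) (u * phi u).
Proof.
move=> hphi; set I0 := f x * _; set I1 := \int[mu]_(u in `[-1, 1]) (u * phi u).
apply/cvgrPdist_le => e e0; near=> t.
have : `|design_mean (N t) (xs (N t)) x (h t) phi - (I0 + h t * derive01 f x * I1)|
    <= e * h t by near: t; exact: (design_mean_near hphi).
have ht := h_gt0 t; have ht0 := lt0r_neq0 ht.
move=> key; rewrite -(ler_pM2r ht) -[X in _ * X <= _](gtr0_norm ht) -normrM.
apply: le_trans key; rewrite -normrN le_eqVlt; apply/orP; left.
by apply/eqP; congr `|_|; field.
Unshelve. all: by end_near. Qed.

End asymptotics_of_design_means.

(** * Convergence of solutions of linear systems with converging coefficients *)

Section perturbed_linear_systems.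
Context {R : realType} {T : Type} (F : set_system T) {FF : ProperFilter F}.

Lemma cvg_bigsum (I : Type) (r : seq I) (P : pred I) (f : I -> T -> R) (a : I -> R) :
  (forall i, f i t @[t --> F] --> a i) ->
  \sum_(i <- r | P i) f i t @[t --> F] --> \sum_(i <- r | P i) a i.
Proof. by move=> fa; apply: cvg_big => [|i _]; [exact: add_continuous|exact: fa]. Qed.

Lemma cvg_bigprod (I : Type) (r : seq I) (P : pred I) (f : I -> T -> R) (a : I -> R) :
  (forall i, f i t @[t --> F] --> a i) ->
  \prod_(i <- r | P i) f i t @[t --> F] --> \prod_(i <- r | P i) a i.
Proof. by move=> fa; apply: cvg_big => [|i _]; [exact: mul_continuous|exact: fa]. Qed.

Lemma cvg_det n (A : T -> 'M[R]_n) (B : 'M[R]_n) :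
  (forall i j, A t i j @[t --> F] --> B i j) -> \det (A t) @[t --> F] --> \det B.
Proof.
move=> AB; rewrite /determinant; apply: cvg_bigsum => s.
by apply: cvgM; [exact: cvg_cst|exact: cvg_bigprod].
Qed.

Lemma cvg_adj n (A : T -> 'M[R]_n) (B : 'M[R]_n) i j :
  (forall i j, A t i j @[t --> F] --> B i j) ->
  (\adj (A t)) i j @[t --> F] --> (\adj B) i j.
Proof.
move=> AB; rewrite mxE; under eq_cvg do rewrite mxE.
apply: cvgM; first exact: cvg_cst.
apply: cvg_det => k l; rewrite !mxE; under eq_cvg do rewrite !mxE; exact: AB.
Qed.

(* Cramer's rule: [det (A t) *: eta t = adj (A t) *m r t]. *)
Lemma cvg_linear_system n (A : T -> 'M[R]_n) (B : 'M[R]_n)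
    (eta r : T -> 'cV[R]_n) (l : 'cV[R]_n) (i : 'I_n) :
  \det B != 0 ->
  (forall i j, A t i j @[t --> F] --> B i j) ->
  (\forall t \near F, A t *m eta t = r t) ->
  (forall i, r t i 0 @[t --> F] --> (B *m l) i 0) ->
  eta t i 0 @[t --> F] --> l i 0.
Proof.
move=> dB AB Aeta rl.
have dA := cvg_det AB.
have dA0 := cvgr_neq0 _ dA dB.
have c : (\det (A t))^-1 * (\adj (A t) *m r t) i 0 @[t --> F] -->
    (\det B)^-1 * (\adj B *m (B *m l)) i 0.
  apply: cvgM; first exact: cvgV.
  rewrite mxE; under eq_cvg do rewrite mxE; apply: cvg_bigsum => j.
  by apply: cvgM; [exact: cvg_adj|exact: rl].
rewrite mulmxA mul_adj_mx mul_scalar_mx mxE mulKf// in c.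
apply: cvg_trans c; apply: near_eq_cvg; near=> t.
have <- : A t *m eta t = r t by near: t.
rewrite mulmxA mul_adj_mx mul_scalar_mx mxE mulKf//.
by near: t; exact: dA0.
Unshelve. all: by end_near. Qed.

End perturbed_linear_systems.

(** * Limit of the scaled coefficient error, and the parity cancellation behind it *)

Section local_polynomial_expansion.
Context {R : realType}.
Variables (p : nat) (nu : 'I_p.+1) (K : R -> R).
Hypothesis hK : kernel_density K.
Hypothesis even_p_nu : ~~ odd (p - nu).

(** Odd moments vanish, and for even [k + l] the two signs agree. *)
Lemma mu_sign k l : (-1) ^+ l * mu_ K (k + l) = (-1) ^+ k * mu_ K (k + l).
Proof.
have [kl|kl] := boolP (odd (k + l)); first by rewrite mu_odd_eq0// !mulr0.
congr (_ * _); rewrite -signr_odd -[RHS]signr_odd; congr (_ ^+ _).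
by move: kl; rewrite oddD; case: (odd k); case: (odd l).
Qed.

(* By parity of the moments, [(-1)^(k+p+1) (S^-1 c)_k] solves the system of [S^-1 c]. *)
Lemma Sinv_c_eq0 : (invmx (matS p K) *m vecc p K) nu 0 = 0.
Proof.
have uS := matS_unit p hK.
set w := invmx _ *m _.
have Sw : matS p K *m w = vecc p K by rewrite mulKVmx.
pose w' : 'cV[R]_p.+1 := \col_k ((-1) ^+ (p.+1 + k) * w k 0).
have Sw' : matS p K *m w' = vecc p K.
  apply/colP => k; rewrite -Sw !mxE.
  have -> : \sum_j matS p K k j * w' j 0 =
      (-1) ^+ (p.+1 + k) * \sum_j matS p K k j * w j 0.
    rewrite mulr_sumr; apply: eq_bigr => j _; rewrite !mxE.
    rewrite !exprD mulrA [_ * (_ * _)]mulrCA mulrA mulrA -[_ * _ * mu_ _ _]mulrA.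
    by rewrite -mu_sign; ring.
  have -> : \sum_j matS p K k j * w j 0 = mu_ K (p.+1 + k).
    by move/colP : Sw => /(_ k); rewrite !mxE addSn.
  by rewrite exprD -mulrA mu_sign mulrA -expr2 sqrr_sign mul1r.
have ww : w' = w by rewrite -[w'](mulKmx uS) Sw'.
have := congr1 (fun v : 'cV[R]_p.+1 => v nu 0) ww; rewrite mxE.
have nup : (nu <= p)%N by rewrite -ltnS.
(* As [p - nu] is even, entry [nu] of [w] equals its own opposite. *)
have -> : (-1) ^+ (p.+1 + nu) = -1 :> R.
  have onu : odd nu = odd p.
    by move: even_p_nu; rewrite oddB//; case: (odd p); case: (odd nu).
  by rewrite -signr_odd oddD onu /= addNb addbb expr1.
move=> /eqP; rewrite mulN1r eq_sym -subr_eq0 opprK -mulr2n mulrn_eq0/= => /eqP.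
by [].
Qed.

Lemma lambdaA_E : lambdaA nu K = (invmx (matS p K) *m vecct p K) nu 0.
Proof. by rewrite /lambdaA -mulmxA /evec trmx_delta -rowE mxE. Qed.

Lemma lambdaB_E : lambdaB nu K =
  (invmx (matS p K) *m matSt p K *m invmx (matS p K) *m vecc p K) nu 0.
Proof. by rewrite /lambdaB -!mulmxA /evec trmx_delta -rowE mxE. Qed.

Context {T : Type} (F : set_system T) {FF : ProperFilter F}.
Variables (s : nat -> T -> R) (h : T -> R) (a b m1 m2 : R).
Hypothesis a_neq0 : a != 0.
Hypothesis h_neq0 : forall t, h t != 0.
Hypothesis sl : forall k, s k t @[t --> F] --> a * mu_ K k.
Hypothesis sl' : forall k, (s k t - a * mu_ K k) / h t @[t --> F] --> b * mu_ K k.+1.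
Variables (delta : T -> 'cV[R]_p.+1) (rem : T -> 'cV[R]_p.+1).
Hypothesis rem0 : forall l, rem t l 0 @[t --> F] --> (0 : R).
Hypothesis system : \forall t \near F,
  (\matrix_(k, l) s (k + l) t) *m delta t =
  \col_l (h t ^+ p.+1 * m1 * s (p + l).+1 t + h t ^+ p.+2 * m2 * s (p + l).+2 t
    + h t ^+ p.+2 * rem t l 0).

(** The vector [delta / h^(p+2)] may diverge like [(m1 / h) w] with [w = S^-1 c]. Subtracting this
    term gives [eta], which solves a system with converging data and limit [l]; entry [nu] is
    unaffected because [w] vanishes there. In the application [a] and [b] are [f x] and [f' x], and
    [m1], [m2] are Taylor coefficients of [m]. *)
Lemma fit_error_cvg :
  delta t nu 0 / h t ^+ p.+2 @[t --> F] -->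
    m1 * (b / a) * (lambdaA nu K - lambdaB nu K) + m2 * lambdaA nu K.
Proof.
have uS := matS_unit p hK.
set Si := invmx (matS p K).
pose w := Si *m vecc p K.
pose eta t := h t ^- p.+2 *: delta t - (m1 / h t) *: w.
pose l := (m1 * (b / a)) *: (Si *m (vecct p K - matSt p K *m w)) + m2 *: (Si *m vecct p K).
have -> : m1 * (b / a) * (lambdaA nu K - lambdaB nu K) + m2 * lambdaA nu K = l nu 0.
  by rewrite /l lambdaA_E lambdaB_E mulmxBr -/Si -!mulmxA -/w !mxE.
have -> : (fun t => delta t nu 0 / h t ^+ p.+2) = (fun t => eta t nu 0).
  have w0 : w nu 0 = 0 by exact: Sinv_c_eq0.
  have lin (u v : 'cV[R]_p.+1) c d : (c *: u - d *: v) nu 0 = c * u nu 0 - d * v nu 0.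
    by rewrite !mxE.
  by apply/funext => t; rewrite /eta lin w0 mulr0 subr0 mulrC.
(* The right-hand side of the system for [eta]: by [S w = c] the limits of the moments cancel, so
   the terms in [1 / h] become the rates of the hypothesis [sl']. *)
pose r t : 'cV[R]_p.+1 := \col_l (
  m1 * ((s (p + l).+1 t - a * mu_ K (p + l).+1) / h t
        - \sum_(k < p.+1) (s (l + k) t - a * mu_ K (l + k)) / h t * w k 0)
  + m2 * s (p + l).+2 t + rem t l 0).
apply: (@cvg_linear_system _ _ F _ _ (fun t => \matrix_(k, l) s (k + l) t)
  (a *: matS p K) eta r).
- by rewrite detZ mulf_neq0 ?expf_neq0// -unitfE -unitmxE.
- by move=> i j; rewrite !mxE; under eq_cvg do rewrite !mxE; exact: sl.
- near=> t; have sys : (\matrix_(k, l) s (k + l) t) *m delta t =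
    \col_l (h t ^+ p.+1 * m1 * s (p + l).+1 t + h t ^+ p.+2 * m2 * s (p + l).+2 t
    + h t ^+ p.+2 * rem t l 0) by near: t.
  rewrite /eta mulmxBr -!scalemxAr sys; apply/colP => i; rewrite !mxE.
  have -> : \sum_(k < p.+1) (s (i + k) t - a * mu_ K (i + k)) / h t * w k 0 =
      (\sum_j (\matrix_(k, l) s (k + l) t) i j * w j 0 - a * mu_ K (p + i).+1) / h t.
    have <- : \sum_j matS p K i j * w j 0 = mu_ K (p + i).+1.
      have /colP/(_ i) : matS p K *m w = vecc p K by rewrite mulKVmx.
      by rewrite !mxE.
    rewrite mulr_sumr -sumrB mulr_suml; apply: eq_bigr => j _; rewrite !mxE.
    by ring.
  have ht := h_neq0 t; have hp : h t ^+ p != 0 by rewrite expf_neq0.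
  by rewrite !exprS; field; rewrite ht hp.
- move=> i; have -> : ((a *: matS p K) *m l) i 0 =
    m1 * (b * mu_ K (p + i).+2 - \sum_(k < p.+1) b * mu_ K (i + k).+1 * w k 0)
    + m2 * (a * mu_ K (p + i).+2) + 0.
    have -> : (a *: matS p K) *m l =
      (m1 * b) *: (vecct p K - matSt p K *m w) + (m2 * a) *: vecct p K.
      rewrite /l mulmxDr -!scalemxAl -!scalemxAr !mulmxA mulmxV// !mul1mx.
      by rewrite !scalerA; congr (_ *: _ + _ *: _); field.
    rewrite !mxE addr0.
    have -> : \sum_(k < p.+1) b * mu_ K (i + k).+1 * w k 0 =
        b * \sum_j matSt p K i j * w j 0.
      by rewrite mulr_sumr; apply: eq_bigr => j _; rewrite !mxE mulrA.
    by ring.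
  under eq_cvg do rewrite mxE.
  apply: cvgD => //; apply: cvgD; last first.
    by apply: cvgM; [exact: cvg_cst|exact: sl].
  apply: cvgM; first exact: cvg_cst.
  apply: cvgB; first exact: sl'.
  apply: cvg_bigsum => k; apply: cvgM; last exact: cvg_cst.
  exact: sl'.
Unshelve. all: by end_near. Qed.

End local_polynomial_expansion.

(** * Normal equations, and the fit as a linear function of the data *)

Section local_polynomial_fits.
Context {R : realType}.
Variables (p : nat) (K : R -> R) (h : R) (N : nat) (xs : nat -> R) (x : R).
Hypothesis h_gt0 : 0 < h.
Implicit Types (y : nat -> R) (beta : 'cV[R]_p.+1).

Definition design_moment k : R := design_mean N xs x h (moment_fun K k).

Definition data_moment y l : R :=
  (N.-1%:R * h)^-1 * \sum_(j < N) y j * moment_fun K l ((xs j - x) / h).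

Definition design_gram : 'M[R]_p.+1 := \matrix_(k, l) design_moment (k + l).

(** First-order condition at a minimum: if [a] were nonzero, the parabola would be negative at
    [t = a / (b + 1)]. *)
Lemma eq0_of_parabola_ge0 (a b : R) : (forall t, 0 <= t ^+ 2 * b - 2 * t * a) -> a = 0.
Proof.
move=> H; apply/eqP; apply: contraT => a0.
have b0 : 0 <= b by have := H 1; have := H (-1); rewrite expr2; lra.
have b1 : 0 < b + 1 by lra.
have := H (a / (b + 1)).
have -> : (a / (b + 1)) ^+ 2 * b - 2 * (a / (b + 1)) * a =
   - ((a / (b + 1)) ^+ 2 * (b + 2)) by field; rewrite gt_eqF.
rewrite oppr_ge0 leNgt mulr_gt0//; last lra.
by rewrite exprn_even_gt0//= mulf_neq0// invr_eq0 gt_eqF.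
Qed.

(** Along the line [beta + t e_l] the excess of the criterion over its minimum is a parabola in [t],
    whose linear coefficient must vanish. *)
Lemma normal_equations y beta : is_local_poly_fit K h N xs y x beta ->
  forall l : 'I_p.+1, \sum_(j < N) (y j - \sum_(k < p.+1) beta k 0 * (xs j - x) ^+ k)
    * (xs j - x) ^+ l * (h^-1 * K ((xs j - x) / h)) = 0.
Proof.
move=> fit l.
pose r j := y j - \sum_(k < p.+1) beta k 0 * (xs j - x) ^+ k.
pose W j := h^-1 * K ((xs j - x) / h).
apply: (@eq0_of_parabola_ge0 _ (\sum_(j < N) ((xs j - x) ^+ l) ^+ 2 * W j)) => t.
have := fit (beta + t *: delta_mx l 0).
rewrite /wls -subr_ge0 -sumrB !mulr_sumr -sumrB.
congr (0 <= _); apply: eq_bigr => j _.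
have -> : \sum_(k < p.+1) (beta + t *: delta_mx l 0) k 0 * (xs j - x) ^+ k =
    \sum_(k < p.+1) beta k 0 * (xs j - x) ^+ k + t * (xs j - x) ^+ l.
  under eq_bigr do rewrite !mxE mulrDl.
  rewrite big_split/=; congr (_ + _).
  rewrite (bigD1 l)//= !eqxx mulr1 big1 ?addr0// => k kl.
  by rewrite (negbTE kl) mulr0 mul0r.
by rewrite -/(W j); ring.
Qed.

(** Coefficients with respect to the powers of [(xs j - x) / h], for which the Gram matrix has an
    invertible limit. *)
Definition scaled_coef beta : 'cV[R]_p.+1 := \col_k (h ^+ k * beta k 0).

Lemma design_gram_mul beta (l : 'I_p.+1) :
  (design_gram *m scaled_coef beta) l 0 =
  data_moment (fun j => \sum_(k < p.+1) beta k 0 * (xs j - x) ^+ k) l.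
Proof.
have h0 := lt0r_neq0 h_gt0.
rewrite mxE /data_moment.
under eq_bigr do rewrite !mxE /design_moment /design_mean -mulrA mulr_suml.
rewrite -mulr_sumr exchange_big/=; congr (_ * _); apply: eq_bigr => j _.
rewrite mulr_suml; apply: eq_bigr => k _.
have -> : (xs j - x) ^+ k = h ^+ k * ((xs j - x) / h) ^+ k.
  by rewrite -exprMn mulrC divfK.
by rewrite /moment_fun exprD; ring.
Qed.

Lemma scaled_normal_equations y beta : is_local_poly_fit K h N xs y x beta ->
  design_gram *m scaled_coef beta = \col_l data_moment y l.
Proof.
move=> /normal_equations fit; apply/colP => l.
rewrite design_gram_mul [RHS]mxE; apply/esym/eqP.
rewrite -subr_eq0 -mulrBr -sumrB mulf_eq0; apply/orP; right; apply/eqP.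
have h0 := lt0r_neq0 h_gt0.
apply: (mulfI (_ : h ^+ l * h^-1 != 0)); first by rewrite mulf_neq0 ?expf_neq0 ?invr_eq0.
rewrite mulr0 -[RHS](fit l) mulr_sumr; apply: eq_bigr => j _.
have -> : (xs j - x) ^+ l = h ^+ l * ((xs j - x) / h) ^+ l.
  by rewrite -exprMn mulrC divfK.
by rewrite /moment_fun; ring.
Qed.

(** The weights depend on the design but not on the data, so the expectation passes through them;
    [h ^- i] undoes the scaling. *)
Definition fit_weight (i : 'I_p.+1) (j : nat) : R :=
  h ^- i * \sum_(l < p.+1) invmx design_gram i l *
    ((N.-1%:R * h)^-1 * moment_fun K l ((xs j - x) / h)).

Lemma fit_weightE y i : \sum_(j < N) fit_weight i j * y j =
  h ^- i * (invmx design_gram *m \col_l data_moment y l) i 0.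
Proof.
rewrite mxE; under eq_bigr do rewrite -mulrA mulr_suml.
rewrite -mulr_sumr; congr (_ * _); rewrite exchange_big/=; apply: eq_bigr => l _.
rewrite mxE /data_moment !mulr_sumr; apply: eq_bigr => j _; ring.
Qed.

Lemma local_poly_fit_coef y beta i : design_gram \in unitmx ->
  is_local_poly_fit K h N xs y x beta ->
  beta i 0 = \sum_(j < N) fit_weight i j * y j.
Proof.
move=> uG /scaled_normal_equations fit; rewrite fit_weightE -fit mulKmx// mxE mulKf//.
by rewrite expf_neq0// gt_eqF.
Qed.

End local_polynomial_fits.

(** * Integrability and expectation of linear combinations of the averaged observations *)

Section mean_of_a_linear_estimator.
Context {d} {Omega : measurableType d} {R : realType} (P : probability Omega R).
Implicit Types (X : Omega -> R).

Lemma mean_zero_sum (I : Type) (r : seq I) (c : I -> R) (X : I -> Omega -> R) :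
  (forall i, X i \in Lfun P 1%E) -> (forall i, 'E_P[X i]%E = 0%E) ->
  (fun w => \sum_(i <- r) c i * X i w) \in Lfun P 1%E /\
  'E_P[fun w => (\sum_(i <- r) c i * X i w)%R]%E = 0%E.
Proof.
move=> LX EX; elim: r => [|i r [LS ES]].
  rewrite (_ : (fun _ => _) = cst 0); last by apply/funext => w; rewrite big_nil.
  by rewrite expectation_cst; split => //; exact: Lfun_cst.
rewrite (_ : (fun _ => _) = (c i \o* X i) \+ (fun w => \sum_(i <- r) c i * X i w)); last first.
  by apply/funext => w; rewrite big_cons /= mulrC.
have Li : (c i \o* X i) \in Lfun P 1%E by exact: Lfun_scale.
split; first exact: rpredD.
by rewrite expectationD// expectationZl// EX mule0 add0e.
Qed.

Lemma error_processes_mean eps rho i t : error_processes P eps rho ->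
  t \in `[(0 : R), 1] -> eps i t \in Lfun P 1%E /\ 'E_P[eps i t]%E = 0%E.
Proof.
move=> [L2 _ _ E0 _] t01; split; last exact: E0.
by apply: (Lfun_subset12 _ (L2 _ _ t01)); exact: fin_num_measure.
Qed.

(** For [n > 0] averaging leaves [m (xs j)] unchanged, and the rest is a finite combination of
    integrable centred errors. *)
Lemma linear_estimator_mean eps rho m (xs : nat -> R) n N (c : nat -> R) :
  error_processes P eps rho -> (0 < n)%N ->
  (forall j, (j < N)%N -> xs j \in `[(0 : R), 1]) ->
  let Z w := (\sum_(j < N) c j * Ybar m eps xs n w j) in
  Z \in Lfun P 1%E /\ 'E_P[Z]%E = (\sum_(j < N) c j * m (xs j))%:E.
Proof.
move=> err n0 xs01 Z.
have n1 : n%:R != 0 :> R by rewrite pnatr_eq0 -lt0n.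
pose S j w := (\sum_(i < n) n%:R^-1 * eps i (xs j) w).
have S1 (j : 'I_N) : S j \in Lfun P 1%E /\ 'E_P[S j]%E = 0%E.
  have x01 := xs01 _ (ltn_ord j).
  by apply: mean_zero_sum => i; have [] := error_processes_mean i err x01.
have [L1 E1] := mean_zero_sum (index_enum 'I_N) (fun j => c j)
  (fun j => (S1 j).1) (fun j => (S1 j).2).
have -> : Z = cst (\sum_(j < N) c j * m (xs j)) \+ (fun w => \sum_(j < N) c j * S j w).
  apply/funext => w /=; rewrite -big_split/=; apply: eq_bigr => j _.
  rewrite -mulrDr; congr (_ * _); rewrite /Ybar /S big_split/= mulrDr.
  by rewrite sumr_const card_ord -[m (xs j) *+ n]mulr_natl mulKf// -mulr_sumr.
split; first by apply: rpredD => //; exact: Lfun_cst.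
by rewrite expectationD ?expectation_cst ?E1 ?adde0//; exact: Lfun_cst.
Qed.

End mean_of_a_linear_estimator.

(** * The fit of the noise-free data [m (xs j)] *)

Section deterministic_fit_error.
Context {R : realType} {T : Type} (F : set_system T) {FF : ProperFilter F}.
Variables (p : nat) (nu : 'I_p.+1) (K m f : R -> R) (x : R).
Variables (h : T -> R) (N : T -> nat) (xs : nat -> nat -> R).
Hypothesis even_p_nu : ~~ odd (p - nu).
Hypothesis hK : kernel_density K.
Hypothesis hm : C01 p.+2 m.
Hypothesis Cf : C01 1 f.
Hypothesis df : density01 f.
Hypothesis bf : bias_equation nu K m f.
Hypothesis x01 : x \in `]0, 1[.
Hypothesis h_gt0 : forall t, 0 < h t.
Hypothesis h0 : h t @[t --> F] --> (0 : R).
Hypothesis Nh : ((N t)%:R * h t ^+ 2 : R) @[t --> F] --> +oo.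
Hypothesis hxs : forall M, (1 < M)%N -> is_design f M (xs M).

Let s k t := design_moment K (h t) (N t) (xs (N t)) x k.
Let G t : 'M[R]_p.+1 := design_gram p K (h t) (N t) (xs (N t)) x.

Let f_neq0 : f x != 0.
Proof. by rewrite gt_eqF// df.1//; exact: subset_itv_oo_cc. Qed.

Lemma design_moment_cvg k : s k t @[t --> F] --> f x * mu_ K k.
Proof.
have [C hC] := moment_fun_bump k hK.
exact: (design_mean_cvg Cf df x01 h_gt0 h0 Nh hxs hC).
Qed.

Lemma design_moment_cvg_rate k :
  (s k t - f x * mu_ K k) / h t @[t --> F] --> derive01 f x * mu_ K k.+1.
Proof.
have [C hC] := moment_fun_bump k hK.
have -> : mu_ K k.+1 =
    \int[lebesgue_measure]_(u in `[-1, 1]) (u * moment_fun K k u).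
  by apply: eq_Rintegral => u _; rewrite /moment_fun exprS mulrA.
exact: (design_mean_cvg_rate Cf df x01 h_gt0 h0 Nh hxs hC).
Qed.

Lemma design_gram_unit : \forall t \near F, G t \in unitmx.
Proof.
have dG : \det (G t) @[t --> F] --> \det (f x *: matS p K).
  apply: cvg_det => i j; rewrite !mxE.
  by under eq_cvg do rewrite mxE; exact: design_moment_cvg.
have dS : \det (f x *: matS p K) != 0.
  by rewrite detZ mulf_neq0 ?expf_neq0// -unitfE -unitmxE matS_unit.
have dG0 := cvgr_neq0 _ dG dS; near=> t.
by rewrite unitmxE unitfE; near: t; exact: dG0.
Unshelve. all: by end_near. Qed.

Let b0 : 'cV[R]_p.+1 := \col_k (derive01n k m x / k`!%:R).
Let m1 := derive01n p.+1 m x / p.+1`!%:R.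
Let m2 := derive01n p.+2 m x / p.+2`!%:R.

(** Scaled coefficients of the noise-free fit minus the scaled Taylor coefficients of [m] at [x];
    this reading holds once [G t] is invertible, which is eventually the case. *)
Definition fit_error t : 'cV[R]_p.+1 :=
  invmx (G t) *m (\col_l data_moment K (h t) (N t) (xs (N t)) x
                    (fun j => m (xs (N t) j)) l) - scaled_coef (h t) b0.

Let rem t : 'cV[R]_p.+1 := \col_l data_moment K (h t) (N t) (xs (N t)) x
  (fun j => (m (xs (N t) j) - taylor_poly p.+2 m x (xs (N t) j)) / h t ^+ p.+2) l.

(** Only nodes closer to [x] than [h] have nonzero weight, and there the Peano remainder is at most
    [e' * h^(p+2)]. The sum is thus at most [e'] times the zeroth design moment, which stays
    bounded. *)
Let rem_cvg l : rem t l 0 @[t --> F] --> (0 : R).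
Proof.
apply/cvgr0Pnorm_le => e e0.
pose B := f x * mu_ K 0 + 1.
have B0 : 0 < `|B| + 1 by rewrite ltr_wpDl.
pose e' := e / (`|B| + 1).
have e'0 : 0 < e' by rewrite divr_gt0.
have /nbhs_ballP[r /= r0 hr] := taylor_peano x01 hm e'0.
have [_ _ K0 _ _] := hK.
near=> t.
have ht := h_gt0 t; have ht0 := lt0r_neq0 ht.
have hr' : h t < r by near: t; exact: (bandwidth_lt h0).
have N1 : (1 < N t)%N by near: t; exact: (sample_size_gt1 h_gt0 h0 Nh).
have M0 : 0 < (N t).-1%:R * h t.
  by rewrite mulr_gt0// ltr0n -ltnS prednK// (ltn_trans _ N1).
have sB : s 0%N t <= B.
  rewrite /B -lerBlDl; apply/ltW; apply: le_lt_trans (ler_norm _) _.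
  rewrite distrC; near: t.
  by have /cvgrPdist_lt := @design_moment_cvg 0%N; apply.
apply: (@le_trans _ _ (e' * s 0%N t)); last first.
  apply: (@le_trans _ _ (e' * (`|B| + 1))); last by rewrite /e' divfK// gt_eqF.
  rewrite ler_wpM2l ?(ltW e'0)//; apply: (le_trans sB).
  by apply: (le_trans (ler_norm _)); rewrite lerDl.
rewrite mxE /data_moment /s /design_moment /design_mean normrM.
rewrite ger0_norm ?invr_ge0 ?(ltW M0)// mulrCA ler_wpM2l ?invr_ge0 ?(ltW M0)//.
apply: (le_trans (ler_norm_sum _ _ _)); rewrite mulr_sumr; apply: ler_sum => j _.
set u := (_ / h t).
have [u1|u1] := leP 1 `|u|.
  by rewrite /moment_fun (kernel_density_eq0 hK u1) !mulr0 normr0.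
rewrite normrM ler_pM//.
  have xE : xs (N t) j - x = u * h t by rewrite /u divfK.
  rewrite normrM normfV ler_pdivrMr ?normr_gt0 ?expf_neq0//.
  rewrite [`|h t ^+ _|]ger0_norm ?exprn_ge0 ?(ltW ht)//.
  have xr : ball x r (xs (N t) j).
    rewrite -ball_normE/= distrC xE normrM (gtr0_norm ht).
    by apply: lt_trans hr'; rewrite -[ltRHS]mul1r ltr_pM2r.
  apply: (le_trans (hr _ xr)); rewrite ler_wpM2l ?(ltW e'0)//.
  rewrite lerXn2r ?nnegrE ?(ltW ht)//.
  by rewrite xE normrM (gtr0_norm ht) -[leRHS]mul1r ler_wpM2r ?(ltW ht)// ltW.
rewrite /moment_fun expr0 mul1r normrM (ger0_norm (K0 _)) -[leRHS]mul1r ler_wpM2r//.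
by rewrite normrX exprn_ile1// ltW.
Unshelve. all: by end_near. Qed.

(** The Gram matrix reproduces the Taylor terms of degree at most [p] exactly, so they cancel; the
    two next terms and the remainder survive. *)
Lemma fit_error_system : \forall t \near F, G t *m fit_error t =
  \col_l (h t ^+ p.+1 * m1 * s (p + l).+1 t + h t ^+ p.+2 * m2 * s (p + l).+2 t
    + h t ^+ p.+2 * rem t l 0).
Proof.
near=> t; have uG : G t \in unitmx by near: t; exact: design_gram_unit.
have ht0 := lt0r_neq0 (h_gt0 t).
rewrite /fit_error mulmxBr mulKVmx//; apply/colP => l.
have sub (u v : 'cV[R]_p.+1) : (u - v) l 0 = u l 0 - v l 0 by rewrite !mxE.
rewrite sub design_gram_mul//.
rewrite !mxE /data_moment /s /design_moment /design_mean -mulrBr -sumrB.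
have dist (c q1 q2 q3 s1 s2 s3 : R) : q1 * (c * s1) + q2 * (c * s2) + q3 * (c * s3)
    = c * (q1 * s1 + q2 * s2 + q3 * s3) by ring.
rewrite dist; congr (_ * _).
rewrite !mulr_sumr -!big_split/=; apply: eq_bigr => j _.
set u := (_ / h t).
have xE : xs (N t) j - x = h t * u by rewrite /u mulrC divfK.
clearbody u.
have -> : taylor_poly p.+2 m x (xs (N t) j) =
    \sum_(k < p.+1) b0 k 0 * (xs (N t) j - x) ^+ k +
    m1 * (xs (N t) j - x) ^+ p.+1 + m2 * (xs (N t) j - x) ^+ p.+2.
  rewrite /taylor_poly 2!big_ord_recr/=; congr (_ + _ + _).
  by apply: eq_bigr => k _; rewrite mxE.
rewrite !xE !exprMn; set S := \sum_(k < _) _.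
rewrite /moment_fun -[(p + l).+1]addSn -[(p.+1 + l).+1]addSn !exprD.
have hp : h t ^+ p.+2 != 0 by rewrite expf_neq0.
by field.
Unshelve. all: by end_near. Qed.

(** The general limit, taken at [a = f x] and [b = f' x], is the left-hand side of the bias equation
    at [x]. *)
Lemma fit_error_cvg0 : fit_error t nu 0 / h t ^+ p.+2 @[t --> F] --> (0 : R).
Proof.
have -> : (0 : R) = m1 * (derive01 f x / f x) * (lambdaA nu K - lambdaB nu K)
                   + m2 * lambdaA nu K.
  by rewrite addrC bf//; exact: subset_itv_oo_cc.
apply: (fit_error_cvg hK even_p_nu f_neq0 _ design_moment_cvg design_moment_cvg_rate
  rem_cvg fit_error_system).
by move=> t; exact: lt0r_neq0.
Qed.

End deterministic_fit_error.

(** * The solution of the bias equation and the resulting order of the bias *)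

Theorem mainTheorem5 (R : realType) (p : nat) (nu : 'I_p.+1)
    (K m : R -> R) (d0 : R)
    (even_p_nu : ~~ odd (p - nu))
    (hK : kernel_density K)
    (hm : C01 p.+2 m)
    (hm_neq0 : forall x : R, x \in `[0, 1] -> derive01n p.+1 m x != 0)
    (hBA : lambdaB nu K - lambdaA nu K != 0)
    (hd0 : \int[lebesgue_measure]_(x in `[0, 1]) f0_ nu K m d0 x = 1) :
  let f0 := f0_ nu K m d0 in
  [/\ C01 1 f0 /\ density01 f0,
      bias_equation nu K m f0,
      (forall f : R -> R, C01 1 f -> density01 f -> bias_equation nu K m f ->
         forall x : R, x \in `[0, 1] -> f x = f0 x) &
      forall (d : measure_display) (Omega : measurableType d)
        (P : probability Omega R)
        (eps : nat -> R -> Omega -> R) (rho : R -> R -> R)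
        (h : nat -> nat -> R) (xs : nat -> nat -> R) (x : R)
        (betahat : nat -> nat -> Omega -> 'cV[R]_p.+1),
      error_processes P eps rho ->
      regular_covariance rho ->
      (forall n N, 0 < h n N) ->
      h nN.1 nN.2 @[nN --> filter_prod \oo \oo] --> (0 : R) ->
      (nN.2%:R * h nN.1 nN.2 ^+ 2 : R) @[nN --> filter_prod \oo \oo] --> +oo ->
      (nN.1%:R * h nN.1 nN.2 ^+ nu.*2 : R) @[nN --> filter_prod \oo \oo]
        --> +oo ->
      (forall N, (1 < N)%N -> is_design f0 N (xs N)) ->
      x \in `]0, 1[ ->
      (forall n N w, (0 < n)%N -> (1 < N)%N ->
         is_local_poly_fit K (h n N) N (xs N) (Ybar m eps (xs N) n w) x
           (betahat n N w)) ->
      (\forall nN \near filter_prod \oo \oo,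
         P.-integrable setT (EFin \o mhat nu (betahat nN.1 nN.2))) /\
      (fun nN : nat * nat => Bias P nu m x (betahat nN.1 nN.2))
        =o_ (filter_prod \oo \oo)
      (fun nN : nat * nat => h nN.1 nN.2 ^+ (p + 2 - nu))].
Proof.
move=> f0.
have Cf0 : C01 1 f0 := f0_C01 nu K d0 hm hm_neq0.
have df0 : density01 f0.
  by split=> [x x01|//]; exact: f0_gt0 hm hm_neq0 hd0 x x01.
have bf0 : bias_equation nu K m f0 := f0_bias_equation hm hm_neq0 hd0 hBA.
split=> //; first exact: bias_equation_unique.
move=> d Omega P eps rho h xs x betahat err _ h_gt0 h0 Nh _ hxs x01 fit.
set F := filter_prod _ _ in h0 Nh *.
pose hh (t : nat * nat) := h t.1 t.2.
pose G t := design_gram p K (hh t) t.2 (xs t.2) x.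
have hh_gt0 t : 0 < hh t by exact: h_gt0.
have n_gt0 : \forall t \near F, (0 < t.1)%N.
  exists ([set n | (0 < n)%N], setT); last by move=> [n N] [].
  by split; [exact: nbhs_infty_gt|exact: filterT].
have N_gt1 : \forall t \near F, (1 < t.2)%N by exact: (sample_size_gt1 hh_gt0 h0 Nh).
have uG : \forall t \near F, G t \in unitmx.
  exact: (design_gram_unit p hK Cf0 df0 x01 hh_gt0 h0 Nh hxs).
(* An invertible Gram matrix forces any pointwise choice of minimiser to be the weighted sum;
   measurability and integrability of the estimator follow from this formula. *)
have mhatE t : (0 < t.1)%N -> (1 < t.2)%N -> G t \in unitmx ->
    mhat nu (betahat t.1 t.2) \in Lfun P 1%E /\
    'E_P[mhat nu (betahat t.1 t.2)]%E = (\sum_(j < t.2)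
      nu`!%:R * fit_weight K (hh t) t.2 (xs t.2) x nu j * m (xs t.2 j))%:E.
  move=> n0 N1 ut; have xs01 j : (j < t.2)%N -> xs t.2 j \in `[(0 : R), 1].
    by move=> /(hxs _ N1) [].
  have -> : mhat nu (betahat t.1 t.2) = fun w => \sum_(j < t.2)
      nu`!%:R * fit_weight K (hh t) t.2 (xs t.2) x nu j * Ybar m eps (xs t.2) t.1 w j.
    apply/funext => w; rewrite /mhat.
    rewrite (local_poly_fit_coef (hh_gt0 t) nu ut (fit t.1 t.2 w n0 N1)) mulr_sumr.
    by apply: eq_bigr => j _; rewrite mulrA.
  exact: (linear_estimator_mean m (fun j => nu`!%:R *
    fit_weight K (hh t) t.2 (xs t.2) x nu j) err n0 xs01).
split.
  near=> t; apply/Lfun1_integrable.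
  have [|||//] := mhatE t; by near: t.
pose er t := fit_error p K m x hh snd xs t nu 0.
have er0 : er t / hh t ^+ p.+2 @[t --> F] --> (0 : R).
  exact: (fit_error_cvg0 even_p_nu hK hm Cf0 df0 bf0 x01 hh_gt0 h0 Nh hxs).
apply/eqoP => e e0; near=> t.
have ht := hh_gt0 t; have ht0 := lt0r_neq0 ht.
have nuf : nu`!%:R != 0 :> R by rewrite pnatr_eq0 -lt0n fact_gt0.
have [|||_ E] := mhatE t; [by near: t..|].
rewrite /Bias E /=.
under eq_bigr do rewrite -mulrA; rewrite -mulr_sumr.
rewrite (@fit_weightE _ p K (hh t) t.2 (xs t.2) x (fun j => m (xs t.2 j)) nu).
set v := (invmx _ *m _) nu 0.
(* After multiplication by [nu! * h^(-nu)] the second summand is [m^(nu)(x)], so the bias is the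
   rescaled error [er]. *)
have vE : v = er t + hh t ^+ nu * (derive01n nu m x / nu`!%:R).
  have sub (u w : 'cV[R]_p.+1) : (u - w) nu 0 = u nu 0 - w nu 0 by rewrite !mxE.
  by rewrite /er /fit_error sub [X in _ - X + _]mxE [X in _ * X]mxE subrK.
have -> : nu`!%:R * (hh t ^- nu * v) - derive01n nu m x =
    nu`!%:R * (er t / hh t ^+ nu).
  by rewrite vE; field; rewrite nuf expf_neq0.
have small : `|er t / hh t ^+ p.+2| <= e / nu`!%:R.
  near: t; move/cvgr0Pnorm_le : er0; apply.
  by rewrite divr_gt0// ltr0n fact_gt0.
have nup : (nu <= p + 2)%N by rewrite (leq_trans (ltnW (ltn_ord nu)))// addn2.
(* The natural subtraction is exact because [nu <= p + 2]. *)
have hE : hh t ^+ p.+2 = hh t ^+ (p + 2 - nu) * hh t ^+ nu.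
  by rewrite -exprD subnK// addn2.
have -> : nu`!%:R * (er t / hh t ^+ nu) =
    nu`!%:R * (er t / hh t ^+ p.+2) *
    hh t ^+ (p + 2 - nu).
  by rewrite hE; field; rewrite !expf_neq0.
rewrite normrM ler_wpM2r// normrM ger0_norm ?ler0n//.
by rewrite mulrC -ler_pdivlMr// ltr0n fact_gt0.
Unshelve. all: by end_near. Qed.
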